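(* Let $h\ge 1$ and let $m_0,m_1,\ldots,m_{h-1}$ be integers with $m_i\ge 3$ for all $0\le i<h$. Let $T^1=T^1_{m_0,\ldots,m_{h-1}}$ and $T^2=T^2_{m_0,\ldots,m_{h-1}}$ be the level-wise regular trees of height $h$ with one root and with two roots, respectively. Then the line graphs $\mathcal{L}(T^1)$ and $\mathcal{L}(T^2)$ are lower bound block graphs and $$rn(\mathcal{L}(T^1))=(d+1)(n-1)+1-2\sum_{i=1}^{h}\left(m_0\cdot i\cdot\prod_{0<j<i}(m_j-1)\right)-2h,$$ where $d=2h$ and $n=|V(T^1)|$, and $$rn(\mathcal{L}(T^2))=d(n-1)-4\sum_{i=1}^{h}\left(i\cdot\prod_{j=0}^{i-1}(m_j-1)\right)-2h,$$ where $d=2h+1$ and $n=|V(T^2)|$.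
   Context: Graphs are finite and simple. For a connected graph $G$, $d(u,v)$ is the distance and $d(G)$ the diameter. A radio labeling of $G$ is a map $f:V(G)\to\{0,1,2,\ldots\}$ with $|f(u)-f(v)|\ge d(G)+1-d(u,v)$ for all distinct $u,v$. Its span is $\max\{|f(u)-f(v)|:u,v\in V(G)\}$, and $rn(G)$ is the minimum span of a radio labeling of $G$. A block is a maximal connected induced subgraph without cut-vertices (of itself). A block graph is a connected graph all of whose blocks are complete graphs; line graphs of trees are block graphs. The weight at $v$ is $wt(v)=\sum_{u\in V(G)}d(u,v)$, and $W(G)$ is the set of vertices of minimum weight (weight centers). If $|W(G)|\ge2$, then $W(G)$ is contained in a (unique) block, called the central block. The central vertices of $G$ are: the unique weight center if $|W(G)|=1$; all vertices of the central block if $|W(G)|\ge 2$. The level of $v$ is $L(v)=\min\{d(v,w): w \text{ a central vertex}\}$ and $L(G)=\sum_{v\in V(G)}L(v)$. Set $\varepsilon(G)=1$ if $|W(G)|=1$ and $\varepsilon(G)=0$ if $|W(G)|\ge2$. For a block graph $G$ of order $p$ put $LB(G)=(p-1)(d(G)+\varepsilon(G))-2L(G)+\varepsilon(G)$; $G$ is called a lower bound block graph if $rn(G)=LB(G)$. The line graph $\mathcal{L}(T)$ has the edges of $T$ as vertices, two being adjacent if they share an endpoint. A level-wise regular tree is a tree rooted at one vertex $w$ (denoted $T^1_{m_0,\ldots,m_{h-1}}$) or at two adjacent vertices $w,w'$ (denoted $T^2_{m_0,\ldots,m_{h-1}}$), in which all vertices whose minimum distance from the root(s) is $i$ have the same degree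 $m_i$, for $0\le i<h$, where $h$ is the height of the tree (the maximum over vertices of the minimum distance to the roots); the vertices at distance $h$ are leaves. *)

(* Defs.v *)
From HB Require Import structures.
From mathcomp Require Import all_boot all_order all_algebra.
From mathcomp Require Import boolp.

Set Implicit Arguments.
Unset Strict Implicit.
Unset Printing Implicit Defensive.

Record sgraph := SGraph {
  svertex :> finType;
  sedge : rel svertex;
  sedge_sym : symmetric sedge;
  sedge_irrefl : irreflexive sedge
}.
Arguments sedge {s}.

Definition degree (G : sgraph) (v : G) : nat := #|[set u | sedge v u]|.

(* The least length of a walk from [x] to [y]. A shortest walk has fewer than
   #|G| edges; the value is #|G| when [x] and [y] are not connected. *)
Definition gdist (G : sgraph) (x y : G) : nat :=
  find (fun n => [exists p : n.-tuple G, path sedge x p && (last x p == y)])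
       (iota 0 #|G|).

Definition diameter (G : sgraph) : nat :=
  \max_(x : G) \max_(y : G) gdist x y.

(* min_{w in A} d(v, w). As [gdist] never exceeds #|G|, the initial value #|G|
   does not affect the minimum for nonempty [A]. *)
Definition gdist_set (G : sgraph) (A : {set G}) (v : G) : nat :=
  \big[minn/#|G|]_(w in A) gdist v w.

(* Connectedness of the subgraph induced on [S]; it holds for the empty set, so
   that the vertex of a one-vertex graph is not a cut-vertex. *)
Definition connected_in (G : sgraph) (S : {set G}) : bool :=
  [forall x in S, forall y in S,
    connect [rel u v : G | [&& u \in S, v \in S & sedge u v]] x y].

Definition is_connected (G : sgraph) : bool := connected_in [set: G].

Definition is_cut_vertex (G : sgraph) (S : {set G}) (v : G) : bool :=
  (v \in S) && ~~ connected_in (S :\ v).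

Definition nonseparable (G : sgraph) (S : {set G}) : bool :=
  [&& S != set0, connected_in S & [forall v, ~~ is_cut_vertex S v]].

Definition is_block (G : sgraph) (B : {set G}) : bool :=
  maxset (@nonseparable G) B.

Definition is_clique (G : sgraph) (S : {set G}) : Prop :=
  {in S &, forall x y, x != y -> sedge x y}.

Definition block_graph (G : sgraph) : Prop :=
  is_connected G /\ forall B : {set G}, is_block B -> is_clique B.

Definition is_tree (G : sgraph) : Prop :=
  is_connected G /\ forall c : seq G, 2 < size c -> ~~ ucycleb sedge c.

(* The natural subtraction is not truncated on connected graphs, where
   d(u, v) <= d(G). *)
Definition radio_labeling (G : sgraph) (f : G -> nat) : Prop :=
  forall u v : G, u != v -> (diameter G + 1) - gdist u v <= `|f u - f v|%N.

Definition span (G : sgraph) (f : G -> nat) : nat :=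
  \max_(u : G) \max_(v : G) `|f u - f v|%N.

Lemma radio_span_exists (G : sgraph) :
  exists k, `[< exists2 f : G -> nat, radio_labeling f & span f = k >].
Proof.
pose f (v : G) := enum_rank v * (diameter G + 1).
exists (span f); apply/asboolP; exists f => // u v neq_uv.
have neq_r : (enum_rank u : nat) != enum_rank v.
  by apply: contraNneq neq_uv => /ord_inj/enum_rank_inj ->.
apply: leq_trans (leq_subr _ _) _.
rewrite /f !PoszM -GRing.mulrBl abszM leq_pmull // absz_gt0 GRing.subr_eq0.
by rewrite eqz_nat.
Qed.

Definition rn (G : sgraph) : nat := ex_minn (radio_span_exists G).

Definition weight (G : sgraph) (v : G) : nat := \sum_(u : G) gdist u v.

Definition weight_centers (G : sgraph) : {set G} :=
  [set v : G | [forall u : G, weight v <= weight u]].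

(* In a block graph with at least two weight centers there is exactly one block
   containing all of them, so [pick] has no choice to make. *)
Definition central_block (G : sgraph) : {set G} :=
  odflt set0 [pick B : {set G} | is_block B && (weight_centers G \subset B)].

Definition central_vertices (G : sgraph) : {set G} :=
  if #|weight_centers G| == 1 then weight_centers G else central_block G.

Definition level (G : sgraph) (v : G) : nat :=
  gdist_set (central_vertices G) v.

Definition total_level (G : sgraph) : nat := \sum_(v : G) level v.

Definition eps (G : sgraph) : nat := #|weight_centers G| == 1.

Definition LB (G : sgraph) : int :=
  ((#|G|%:Z - 1) * ((diameter G)%:Z + (eps G)%:Z)
     - 2 * (total_level G)%:Z + (eps G)%:Z)%R.

Definition lower_bound_block_graph (G : sgraph) : Prop :=
  block_graph G /\ ((rn G)%:Z = LB G)%R.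

Definition edge_set (G : sgraph) : {set {set G}} :=
  [set E : {set G} | [exists x, exists y, sedge x y && (E == [set x; y])]].

Definition line_rel (G : sgraph) : rel {E : {set G} | E \in edge_set G} :=
  [rel E F | (E != F) && (val E :&: val F != set0)].

Lemma line_rel_sym (G : sgraph) : symmetric (@line_rel G).
Proof. by move=> E F; rewrite /line_rel /= eq_sym setIC. Qed.

Lemma line_rel_irrefl (G : sgraph) : irreflexive (@line_rel G).
Proof. by move=> E; rewrite /line_rel /= eqxx. Qed.

Definition line_graph (G : sgraph) : sgraph :=
  SGraph (@line_rel_sym G) (@line_rel_irrefl G).

(* Trees with root set [R]; only the values [m i] with [i < h] matter. *)
Definition level_regular_tree (T : sgraph) (R : {set T}) (h : nat)
    (m : nat -> nat) : Prop :=
  [/\ is_tree T,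
      \max_(v : T) gdist_set R v = h,
      forall v : T, gdist_set R v < h -> degree v = m (gdist_set R v)
    & forall v : T, gdist_set R v = h -> degree v = 1].

Definition is_T1 (h : nat) (m : nat -> nat) (T : sgraph) : Prop :=
  exists w : T, level_regular_tree [set w] h m.

Definition is_T2 (h : nat) (m : nat -> nat) (T : sgraph) : Prop :=
  exists w w' : T, sedge w w' /\ level_regular_tree [set w; w'] h m.

(* Main.v *)
Require Import Defs.
From mathcomp Require Import all_boot all_order all_algebra.
From mathcomp Require Import zify ring boolp.
Import GRing.Theory.

(** Let [G] be the line graph of the tree, [C] its set of central vertices, [L]
    the distance to [C] and [d] the diameter of [G], and let [e] be 1 if [C] is
    a single vertex and 0 otherwise.

    Lower bound ([radio_span_ge]). Going through [C], any two vertices have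
    distance at most [L x + L y + 1 - e]. So, when the vertices are listed by
    increasing label, consecutive labels differ by at least
    [d + e - L x - L y]. The sum of these bounds is [LB G - e] plus the levels
    of the first and the last vertex, whose sum is at least [e].

    Upper bound ([rn_ordering]). Conversely, an order of the vertices in which
    the end levels have sum [e] yields a labeling whose consecutive gaps have
    exactly this size. As every vertex between [x] and [y] adds at least 1 to
    the difference of their labels, the labeling is a radio labeling as soon as
    two vertices whose distance falls short of [L x + L y + 1 - e] by [k] are
    more than [k] places apart. In the line graph of a tree the shortfall comes
    from common ancestors: if the deepest common ancestor of the lower ends of
    two edges is on level [c] of the tree, then [k] is at most [2 * c] for one
    root ([tree_dist]) and at most [2 * c + 1] for two roots. The edges are
    therefore ordered level by level, and cyclically through all branches at
    once ([position], [rank]): edges with a common ancestor on level [c] have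
    ranks that are congruent modulo the number of vertices on level [c]
    ([rank_gap]). As all degrees are at least 3, this number is at least
    [2 * c + 1] for one root and [2 * c + 2] for two roots. Finally one edge
    of the first level is moved to the end of the order, which makes the levels
    of the ends as small as possible and preserves the congruences.

    It remains to identify the ingredients of [LB G]. All branches at [C] have
    the same size, which is less than half of the order of [G], so every vertex
    outside [C] is heavier than those of [C] ([weight_centers_clique]). The line
    graph of a tree is a block graph because every edge of the tree separates
    the edges below it from the others ([nonseparable_clique]). In such a graph
    a maximal clique is the only block containing it, so [C] is the central
    block if it has more than one element ([central_vertices_clique]). *)

Set Implicit Arguments.
Unset Strict Implicit.
Unset Printing Implicit Defensive.

(** * Distances in a connected graph *)

Section Distance.
Variable G : sgraph.
Implicit Types (x y z : G) (A : {set G}).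

Lemma gdist_le_path x p : path sedge x p -> gdist x (last x p) <= size p.
Proof.
move=> xp; rewrite /gdist; set P := (fun _ : nat => _).
have [small|big] := ltnP (size p) #|G|; last first.
  by apply: leq_trans big; rewrite -[X in _ <= X](size_iota 0) find_size.
rewrite leqNgt; apply/negP => /(before_find 0); rewrite nth_iota // add0n.
have -> // : P (size p); apply/existsP; exists (in_tuple p).
by rewrite xp eqxx.
Qed.

Lemma gdist_le_card x y : gdist x y <= #|G|.
Proof. by rewrite -[X in _ <= X](size_iota 0) find_size. Qed.

Lemma gdist_xx x : gdist x x = 0.
Proof. by apply/eqP; rewrite -leqn0 (@gdist_le_path x [::]). Qed.

Lemma gdist_edge x y : sedge x y -> gdist x y <= 1.
Proof. by move=> xy; apply: (@gdist_le_path x [:: y]); rewrite /= xy. Qed.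

Hypothesis conn : is_connected G.

Lemma connectedT x y : connect sedge x y.
Proof.
have /forall_inP/(_ x (in_setT x))/forall_inP/(_ y (in_setT y)) := conn.
by apply: connect_sub => u v /= /and3P[_ _ uv]; apply: connect1.
Qed.

Lemma gdist_path x y :
  exists p, [/\ path sedge x p, last x p = y & size p = gdist x y].
Proof.
have /connectP[p0 xp0 ->] := connectedT x y.
case/shortenP: xp0 => p xp up _.
set z := last x p.
have ltp : size p < #|G| by have := card_uniqP up; rewrite /= => <-; rewrite max_card.
have hasP : has (fun n => [exists p : n.-tuple G, path sedge x p && (last x p == z)])
                (iota 0 #|G|).
  apply/hasP; exists (size p); first by rewrite mem_iota.
  by apply/existsP; exists (in_tuple p); rewrite xp eqxx.
have := hasP; rewrite has_find size_iota => lt_find.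
have := nth_find 0 hasP; rewrite nth_iota // add0n => /existsP[q /andP[xq /eqP lq]].
by exists q; rewrite size_tuple.
Qed.

Lemma gdist_sym x y : gdist x y = gdist y x.
Proof.
suff le (a b : G) : gdist a b <= gdist b a by apply/eqP; rewrite eqn_leq !le.
have [p [bp <- <-]] := gdist_path b a.
have E : last (last b p) (rev (belast b p)) = b.
  by case: p {bp} => //= y' p; rewrite rev_cons last_rcons.
rewrite -(size_belast b p) -(size_rev (belast b p)) -{2}E.
apply: gdist_le_path; rewrite rev_path.
by rewrite (eq_path (e' := sedge)) // => u v; rewrite /= sedge_sym.
Qed.

Lemma gdist_triangle y x z : gdist x z <= gdist x y + gdist y z.
Proof.
have [p [xp lp <-]] := gdist_path x y; have [q [yq lq <-]] := gdist_path y z.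
rewrite -size_cat -lq -[in last _ _]lp -last_cat gdist_le_path //.
by rewrite cat_path xp lp.
Qed.

Lemma gdist_eq0 x y : (gdist x y == 0) = (x == y).
Proof.
apply/eqP/eqP=> [d0|->]; last exact: gdist_xx.
by have [[|z p] [_ lp sz]] := gdist_path x y; rewrite d0 in sz.
Qed.

Lemma gdist_step x y : x != y ->
  exists2 z, sedge x z & gdist x y = (gdist z y).+1.
Proof.
move=> neq; have [[|z p] [/= xp lp szp]] := gdist_path x y.
  by rewrite lp eqxx in neq.
have/andP[xz zp] := xp.
exists z => //; apply/eqP; rewrite eqn_leq; apply/andP; split.
  by rewrite -add1n (leq_trans (gdist_triangle z _ _)) // leq_add2r gdist_edge.
by rewrite -szp -lp ltnS gdist_le_path.
Qed.

Lemma gdist_set_le A x y : y \in A -> gdist_set A x <= gdist x y.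
Proof.
move=> yA; rewrite /gdist_set; have: y \in index_enum G by rewrite mem_index_enum.
elim: index_enum => // z s IH; rewrite inE big_cons => /predU1P[<-|/IH le_s].
  by rewrite yA geq_minl.
by case: ifP => // _; apply: leq_trans (geq_minr _ _) le_s.
Qed.

(** The start value [#|G|] of the minimum is never below a distance, so the
    minimum over a nonempty set is attained in that set. *)
Lemma gdist_setP A x y0 : y0 \in A ->
  exists2 y, y \in A & gdist_set A x = gdist x y.
Proof.
move=> y0A; rewrite /gdist_set.
have [] // := @big_ind _ (fun n => n = #|G| \/ exists2 y, y \in A & n = gdist x y)
   #|G| minn _ _ _ (index_enum G) (mem A) (gdist x).
- by left.
- by move=> m n Pm Pn; rewrite /minn; case: ifP.
- by move=> y yA; right; exists y.
move=> E; exists y0 => //; apply/eqP; rewrite eqn_leq gdist_set_le //=.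
by rewrite /gdist_set E gdist_le_card.
Qed.

Lemma gdist_set_lip A x y : A != set0 -> gdist_set A x <= gdist x y + gdist_set A y.
Proof.
case/set0Pn=> y0 /(gdist_setP y)[z zA ->].
by rewrite (leq_trans (gdist_set_le _ zA)) ?gdist_triangle.
Qed.

Lemma gdist_set_eq0 A x : A != set0 -> (gdist_set A x == 0) = (x \in A).
Proof.
case/set0Pn=> y0 /(gdist_setP x)[z zA E]; apply/idP/idP.
  by rewrite E gdist_eq0 => /eqP ->.
by move=> xA; rewrite -leqn0 -(gdist_xx x) gdist_set_le.
Qed.

Lemma gdist_le_diam x y : gdist x y <= diameter G.
Proof.
rewrite /diameter; apply: leq_trans (leq_bigmax x).
exact: (leq_bigmax (F := fun y => gdist x y)).
Qed.

Lemma diam_leP k : (forall x y, gdist x y <= k) -> diameter G <= k.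
Proof. by move=> H; apply/bigmax_leqP => x _; apply/bigmax_leqP => y _. Qed.

End Distance.

(** * Radio labelings of a graph with a central clique *)

(** [C] is going to be the set of central vertices, which is a single vertex or
    a clique with at least two vertices. The boolean [single] then equals
    [eps G], and [D = diameter G + eps G] is the number from which the levels
    of two consecutive vertices are subtracted in [LB G]. *)
Section CentralClique.
Variables (G : sgraph) (C : {set G}).
Hypotheses (conn : is_connected G) (C_neq0 : C != set0) (C_clique : is_clique C).

Let L := gdist_set C.
Let single : bool := #|C| == 1.

Lemma gdist_center_eq0 x : (L x == 0) = (x \in C).
Proof. exact: gdist_set_eq0. Qed.

Lemma gdist_through_center x y : gdist x y <= L x + L y + ~~ single.
Proof.
have [c0 c0C] := set0Pn _ C_neq0.
have [c cC Lx] := gdist_setP x c0C; have [c' c'C Ly] := gdist_setP y c0C.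
have dcc : gdist c c' <= ~~ single.
  have [<-|neq] := eqVneq c c'; first by rewrite gdist_xx.
  rewrite (leq_trans (gdist_edge (C_clique cC c'C neq))) //.
  rewrite lt0b; apply: contraNN neq => /cards1P[z Cz].
  by move: cC c'C; rewrite Cz !inE => /eqP-> /eqP->.
have := gdist_triangle conn c x y; have := gdist_triangle conn c' c y.
by rewrite /L Lx Ly (gdist_sym conn y c'); lia.
Qed.

Lemma single_center_uniq x y : single -> L x = 0 -> L y = 0 -> x = y.
Proof.
case/cards1P=> z Cz /eqP + /eqP; rewrite !gdist_center_eq0 Cz !inE.
by move=> /eqP-> /eqP->.
Qed.

Let D := diameter G + single.

Lemma radio_gap (f : G -> nat) (x y : G) : radio_labeling f -> x != y -> f x <= f y ->
  D <= (f y - f x) + L x + L y.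
Proof.
move=> radio neq le_f; have := radio x y neq; have := gdist_through_center x y.
by rewrite /D; case: (single); lia.
Qed.

(** Adding up the consecutive gaps counts the level of every vertex twice,
    except for the two end vertices, whose levels are counted once. *)
Lemma radio_path_span (f : G -> nat) (x : G) (s : seq G) : radio_labeling f -> uniq (x :: s) ->
    path (fun y z => f y <= f z) x s ->
  D * size s + f x + L x + L (last x s) <= f (last x s) + 2 * \sum_(y <- x :: s) L y.
Proof.
move=> radio; elim: s x => [|y s IH] x; first by rewrite big_seq1 /=; lia.
rewrite [uniq _]/= [path _ _ _]/= => /andP[xNys ys_uniq] /andP[le_xy ys_path].
have := IH y ys_uniq ys_path; rewrite [last x _]/= (big_cons _ _ x).
have neq : x != y by apply: contraNneq xNys => ->; rewrite mem_head.
have := radio_gap radio neq le_xy.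
by rewrite [size (y :: s)]/= mulnS; lia.
Qed.

(** The lower bound: sort the vertices by label and add up the gaps. When [C] is
    a single vertex, the two ends cannot both have level 0, which gives the
    summand [single]. *)
Lemma radio_span_ge (f : G -> nat) : radio_labeling f -> 1 < #|G| ->
  #|G|.-1 * D + single <= Defs.span f + 2 * \sum_x L x.
Proof.
move=> radio G_gt1; pose le_f (x y : G) := f x <= f y.
have le_f_total : total le_f by move=> x y; apply: leq_total.
have perm_s : perm_eql (sort le_f (enum G)) (enum G) by apply/permPl; rewrite perm_sort.
have : sorted le_f (sort le_f (enum G)) by apply: sort_sorted.
have : uniq (sort le_f (enum G)) by rewrite sort_uniq enum_uniq.
have : size (sort le_f (enum G)) = #|G| by rewrite size_sort -cardE.
have : \sum_(x <- sort le_f (enum G)) L x = \sum_x L x.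
  by rewrite (perm_big _ (permEl perm_s)) big_enum.
case: sort => [|x s]; first by move=> _ /= E; rewrite -E in G_gt1.
move=> sumE sizeE s_uniq s_path; have := radio_path_span radio s_uniq s_path.
have -> : #|G|.-1 = size s by rewrite -sizeE.
have neq : x != last x s.
  case: s {sumE s_path} sizeE s_uniq => [|y s] /= sizeE; first by rewrite -sizeE in G_gt1.
  by case/andP=> + _; apply: contraNneq => {1}->; apply: mem_last.
have leL : (single : nat) <= L x + L (last x s).
  case E: (single) => //; rewrite lt0n; apply: contraNN neq.
  by rewrite addn_eq0 => /andP[/eqP Lx /eqP Ly]; apply/eqP/single_center_uniq.
have le_span : `|f (last x s) - f x|%N <= Defs.span f.
  rewrite /Defs.span; apply: leq_trans (leq_bigmax (last x s)).
  exact: (leq_bigmax (F := fun v => `|f (last x s) - f v|%N)).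
by rewrite sumE; lia.
Qed.

(** An order of the vertices, given by an injective [g] onto an interval of
    naturals, for which the lower bound is attained. By [g_gap], two vertices
    must be further apart in the order than the amount by which their distance
    falls short of [L x + L y + 1 - single]. *)
Section Ordering.
Variables (g : G -> nat) (a : nat).
Hypotheses (g_inj : injective g) (g_range : forall x, a <= g x < a + #|G|).
Hypothesis g_gap : forall x y, g x < g y ->
  L x + L y + 2 <= gdist x y + single + (g y - g x).
Hypothesis g_ends : forall x y, g x = a -> g y = a + #|G|.-1 ->
  L x + L y = single.
Hypothesis L_small : forall x, 2 * L x < D.

Lemma index_onto k : a <= k < a + #|G| -> exists x, g x = k.
Proof.
move=> k_range; have g_uniq : uniq (map g (enum G)).
  by rewrite map_inj_uniq // enum_uniq.
have sub : {subset map g (enum G) <= iota a #|G|}.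
  by move=> _ /mapP[x _ ->]; rewrite mem_iota.
have [] := uniq_min_size g_uniq sub; first by rewrite size_iota size_map -cardE.
move=> _ eq_mem; have : k \in iota a #|G| by rewrite mem_iota.
by rewrite -eq_mem => /mapP[x _ ->]; exists x.
Qed.

(** The labeling whose consecutive gaps are exactly [D - L x - L y], in a closed
    form that telescopes along the order; the summand [D] only keeps the
    truncated subtraction of [L x] harmless and cancels in differences. *)
Let f (x : G) := \sum_(z | g z < g x) (D - 2 * L z) + (D - L x).

(** Every vertex [z] strictly between [x] and [y] contributes [D - 2 * L z],
    which is at least 1, to the difference of their labels. This is what
    makes far-apart vertices harmless. *)
Lemma label_gap x y : g x < g y ->
  f x + D + (g y - g x).-1 <= f y + L x + L y.
Proof.
move=> lt_g; rewrite /f.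
have -> : \sum_(z | g z < g y) (D - 2 * L z) = \sum_(z | g z < g x) (D - 2 * L z)
    + (D - 2 * L x + \sum_(z | g x < g z < g y) (D - 2 * L z)).
  rewrite (bigID [pred z | g z < g x]) [X in _ + X = _](bigD1 x) /=; last by rewrite lt_g ltnn.
  congr (_ + (_ + _)); apply: eq_bigl => z; last by rewrite -(inj_eq g_inj); lia.
  by rewrite /=; lia.
have : (g y - g x).-1 <= \sum_(z | g x < g z < g y) (D - 2 * L z).
  apply: (@leq_trans #|[set z | g x < g z < g y]|).
    rewrite -{1}(size_iota (g x).+1 (g y - g x).-1).
    have sub : {subset iota (g x).+1 (g y - g x).-1
        <= map g (enum [set z | g x < g z < g y])}.
      move=> k; rewrite mem_iota => k_range.
      have [z zk] : exists z, g z = k.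
        by apply: index_onto; have := g_range x; have := g_range y; lia.
      by apply/mapP; exists z => //; rewrite mem_enum inE zk; lia.
    by have := uniq_leq_size (iota_uniq _ _) sub; rewrite size_map -cardE.
  rewrite -sum1_card (eq_bigl (fun z => g x < g z < g y)) => [|z]; last by rewrite inE.
  by apply: leq_sum => z _; have := L_small z; lia.
by have := L_small x; have := L_small y; lia.
Qed.

Lemma label_radio : radio_labeling f.
Proof.
suff lt_case x y : g x < g y -> (diameter G + 1) - gdist x y <= `|f x - f y|%N.
  move=> x y; rewrite -(inj_eq g_inj) neq_ltn => /orP[/lt_case //|/lt_case].
  by rewrite gdist_sym // distnC.
move=> lt_g; have := label_gap lt_g; have := g_gap lt_g.
by have := L_small x; have := L_small y; rewrite /D; lia.
Qed.

Lemma label_span : 0 < #|G| -> Defs.span f + 2 * \sum_x L x <= #|G|.-1 * D + single.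
Proof.
move=> G_gt0.
have [x0 x0P] : exists x, g x = a by apply: index_onto; lia.
have [x1 x1P] : exists x, g x = a + #|G|.-1 by apply: index_onto; lia.
have mono x y : g x <= g y -> f x <= f y.
  rewrite leq_eqVlt => /predU1P[/g_inj-> //|/label_gap].
  by have := L_small x; have := L_small y; lia.
have Lends := g_ends x0P x1P.
have f0 : f x0 = D - L x0.
  by rewrite /f big_pred0 ?add0n // => z; have := g_range z; lia.
have mulGD : #|G| * D = #|G|.-1 * D + D by rewrite -{1}(prednK G_gt0) mulSn addnC.
have f1 : f x1 + D + 2 * \sum_x L x = #|G| * D + 2 * L x1 + (D - L x1).
  have -> : f x1 = \sum_(z | z != x1) (D - 2 * L z) + (D - L x1).
    congr (_ + _); apply: eq_bigl => z.
    by rewrite -(inj_eq g_inj); have := g_range z; lia.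
  have : \sum_(z | z != x1) (D - 2 * L z) + 2 * \sum_(z | z != x1) L z = #|G|.-1 * D.
    rewrite big_distrr -big_split /= (eq_bigr (fun=> D)) => [|z _]; last first.
      by have := L_small z; lia.
    by rewrite sum_nat_const cardC1.
  have -> : \sum_x L x = L x1 + \sum_(z | z != x1) L z by rewrite (bigD1 x1).
  by rewrite mulGD; have := L_small x1; lia.
have f_range x : f x0 <= f x <= f x1.
  by rewrite !mono //; have := g_range x; lia.
have le_span : Defs.span f <= f x1 - f x0.
  apply/bigmax_leqP => x _; apply/bigmax_leqP => y _.
  by have := f_range x; have := f_range y; lia.
by have := L_small x1; have := L_small x0; have := f_range x1; lia.
Qed.

Lemma rn_ordering : 1 < #|G| -> rn G + 2 * \sum_x L x = #|G|.-1 * D + single.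
Proof.
move=> G_gt1; apply/eqP; rewrite eqn_leq; apply/andP; split; rewrite /rn.
  case: ex_minnP => k _ /(_ (Defs.span f)).
  move/(_ (introT (asboolP _) (ex_intro2 _ _ f label_radio erefl))).
  by have := label_span (ltnW G_gt1); lia.
by case: ex_minnP => k /asboolP[f0 radio <-] _; apply: radio_span_ge.
Qed.

End Ordering.

(** [same e x] says that [x] lies in the branch of [e]. All branches have [B]
    vertices, less than half of all, and a shortest path
    between different branches passes through [C]. *)
Section Weight.
Variables (same : rel G) (B : nat).
Hypotheses (same_card : forall e, #|[set x | same e x]| = B) (B_small : 2 * B < #|G|).
Hypothesis cross : forall e x, ~~ same e x -> L x + L e + ~~ single <= gdist x e.
Hypothesis inner : forall e x, e \in C -> same e x -> gdist x e <= L x.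

Lemma weight_ge e :
  \sum_x L x + (#|G| - B) * (L e + ~~ single) <= weight e + B * L e.
Proof.
have -> : (#|G| - B) * (L e + ~~ single) = \sum_(x | ~~ same e x) (L e + ~~ single).
  by rewrite sum_nat_const -(same_card e) cardsE -(cardC (same e)) addKn.
have -> : B * L e = \sum_(x | same e x) L e.
  by rewrite sum_nat_const -(same_card e) cardsE.
rewrite /weight (bigID (same e) predT) (bigID (same e) predT (fun x : G => gdist x e)) /=.
rewrite -[X in X <= _]addnA [X in _ <= X]addnAC -!big_split /=.
apply: leq_add; apply: leq_sum => x.
  by move=> _; apply: gdist_set_lip.
by move/cross; rewrite addnA.
Qed.

Lemma weight_center_le e : e \in C ->
  weight e <= \sum_x L x + (#|G| - B) * ~~ single.
Proof.
move=> eC; have Le : L e = 0 by apply/eqP; rewrite gdist_center_eq0.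
have -> : (#|G| - B) * ~~ single = \sum_(x | ~~ same e x) ~~ single.
  by rewrite sum_nat_const -(same_card e) cardsE -(cardC (same e)) addKn.
rewrite /weight (bigID (same e)) [\sum_x L x](bigID (same e)) /=.
rewrite -addnA -big_split /=; apply: leq_add; apply: leq_sum => x.
  exact: inner.
by have := gdist_through_center x e; rewrite Le addn0.
Qed.

(** Compared with a vertex of [C], the vertex [e] is nearer by at most [L e] to
    the [B] vertices of its branch, and farther by [L e] from the other ones,
    which are more numerous. *)
Lemma weight_centers_clique : weight_centers G = C.
Proof.
have [c cC] := set0Pn _ C_neq0.
have lt_weight e : e \notin C -> weight c < weight e.
  rewrite -gdist_center_eq0 -lt0n => Le; have := weight_center_le cC.
  have := weight_ge e; rewrite mulnDr.
  suff : B * L e < (#|G| - B) * L e by lia.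
  by rewrite ltn_pmul2r //; lia.
apply/setP=> e; rewrite inE; apply/forallP/idP=> [le_e|eC u].
  by apply: contraTT (le_e c) => /lt_weight; rewrite -ltnNge.
have [uC|/lt_weight] := boolP (u \in C); last first.
  have := weight_center_le eC; have := weight_ge c.
  have -> : L c = 0 by apply/eqP; rewrite gdist_center_eq0.
  by rewrite muln0; lia.
have := weight_center_le eC; have := weight_ge u.
have -> : L u = 0 by apply/eqP; rewrite gdist_center_eq0.
by rewrite muln0; lia.
Qed.

End Weight.

Hypothesis Gblock : block_graph G.
Hypothesis C_max : ~~ single ->
  forall x, {in C, forall c, x != c -> sedge x c} -> x \in C.

Lemma clique_nonseparable S : S != set0 -> is_clique S -> @nonseparable G S.
Proof.
have conn_in (A : {set G}) : is_clique A -> connected_in A.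
  move=> cl; apply/forall_inP=> x xA; apply/forall_inP=> y yA.
  have [->|neq] := eqVneq x y; first exact: connect0.
  by apply: connect1; rewrite /= xA yA cl.
move=> S0 Scl; rewrite /nonseparable S0 conn_in //=.
apply/forallP=> v; rewrite /is_cut_vertex negb_and negbK conn_in ?orbT //.
by move=> x y /setD1P[_ xS] /setD1P[_ yS]; apply: Scl.
Qed.

(** A clique is nonseparable, hence lies in a block; a block of a block graph is
    a clique, so it cannot exceed a maximal clique. Thus [C] is the only
    candidate for the central block. *)
Lemma maximal_clique_block (B : {set G}) : ~~ single ->
  is_block B && (C \subset B) = (B == C).
Proof.
move=> nsingle.
have sub_eq (A : {set G}) : is_block A -> C \subset A -> A = C.
  move=> Ablock CA; apply/eqP; rewrite eqEsubset CA andbT.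
  apply/subsetP=> x xA; apply: C_max => // c cC neq.
  exact: Gblock.2 Ablock _ _ xA (subsetP CA c cC) neq.
apply/andP/eqP=> [[]|->]; first exact: sub_eq.
have [A Amax CA] := maxset_exists (clique_nonseparable C_neq0 C_clique).
by rewrite -{1}(sub_eq A).
Qed.

Lemma central_vertices_clique : weight_centers G = C -> central_vertices G = C.
Proof.
rewrite /central_vertices => WC; rewrite WC; case: ifP => // /negbT nsingle.
rewrite /central_block WC; case: pickP => [B /=|/(_ C)].
  by rewrite maximal_clique_block // => /eqP.
by rewrite maximal_clique_block ?eqxx.
Qed.

Lemma LB_clique : 0 < #|G| -> weight_centers G = C ->
  (LB G = (#|G|.-1 * D)%:Z - (2 * \sum_x L x)%:Z + single%:Z)%R.
Proof.
move=> G0 WC; rewrite /LB /total_level /level central_vertices_clique // /eps WC.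
have -> : (#|G|%:Z - 1 = #|G|.-1%:Z)%R by lia.
by rewrite -/single !PoszM /D PoszD.
Qed.

(** The form in which both families of trees are treated: it remains to supply
    the branches ([same]) and the order ([g]). *)
Theorem lower_bound_criterion (same : rel G) (B : nat) (g : G -> nat) (a : nat) :
    1 < #|G| ->
    (forall e, #|[set x | same e x]| = B) -> 2 * B < #|G| ->
    (forall e x, ~~ same e x -> L x + L e + ~~ single <= gdist x e) ->
    (forall e x, e \in C -> same e x -> gdist x e <= L x) ->
    injective g -> (forall x, a <= g x < a + #|G|) ->
    (forall x y, g x < g y -> L x + L y + 2 <= gdist x y + single + (g y - g x)) ->
    (forall x y, g x = a -> g y = a + #|G|.-1 -> L x + L y = single) ->
    (forall x, 2 * L x < D) ->
  lower_bound_block_graph G /\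
  ((rn G)%:Z = (#|G|.-1 * D)%:Z - (2 * \sum_x L x)%:Z + single%:Z)%R.
Proof.
move=> G_gt1 cardB smallB cross inner g_inj g_range g_gap g_ends L_small.
have WC := weight_centers_clique cardB smallB cross inner.
have rnE := rn_ordering g_inj g_range g_gap g_ends L_small G_gt1.
suff LBE : (Posz (rn G) = LB G).
  by split; [split | rewrite LBE LB_clique // ltnW].
by rewrite LB_clique ?(ltnW G_gt1) //; lia.
Qed.

End CentralClique.

(** * Trees with one root or two adjacent roots *)

(** Parents point towards the root set [R]. A root has no neighbor on a lower
    level, so its parent is the distinguished root [r0]. With at most two
    adjacent roots this makes [v |-> {v, parent v}] a bijection from the
    vertices other than [r0] to the edges. *)
Definition parent (T : sgraph) (R : {set T}) (r0 v : T) : T :=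
  odflt r0 [pick u | sedge v u && (gdist_set R u < gdist_set R v)].

(** The ancestor of [v] on level [c], for [c <= gdist_set R v]. *)
Definition ancestor (T : sgraph) (R : {set T}) (r0 : T) (c : nat) (v : T) : T :=
  iter (gdist_set R v - c) (parent R r0) v.

Definition children (T : sgraph) (R : {set T}) (r0 v : T) : {set T} :=
  [set u | (gdist_set R u == (gdist_set R v).+1) && (parent R r0 u == v)].

(** Two neighbors of [v] joined by a path that avoids [v] would close a cycle
    through [v]. *)
Lemma tree_acyclic (T : sgraph) (v u1 u2 : T) : is_tree T ->
    sedge v u1 -> sedge v u2 ->
    connect [rel x y : T | [&& x != v, y != v & sedge x y]] u1 u2 ->
  u1 = u2.
Proof.
move=> [_ acyc] vu1 vu2 /connectP[p0 path_p0 lp0].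
apply/eqP; rewrite lp0; case/shortenP: path_p0 lp0 => p path_p uniq_p _ lp.
apply/negPn; apply/negP => neq.
have p_gt0 : 0 < size p by case: p neq {path_p uniq_p lp} => //; rewrite eqxx.
have := acyc (v :: u1 :: p); rewrite /= ltnS => /(_ p_gt0) /negP; apply.
rewrite /ucycleb cons_uniq uniq_p andbT /= vu1 rcons_path -lp [sedge u2 v]sedge_sym vu2 andbT.
have neqv (x : T) : sedge v x -> v != x.
  by move=> vx; apply: contraTneq vx => <-; rewrite sedge_irrefl.
rewrite inE (negPf (neqv _ vu1)) /=; apply/andP; split.
  by apply: sub_path path_p => x y /= /and3P[].
elim: p u1 path_p {uniq_p lp neq p_gt0 vu1} => //= x p IH u1 /andP[/and3P[_ xv _] px].
by rewrite inE eq_sym negb_or xv (IH x).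
Qed.

Section RootedTree.
Variables (T : sgraph) (R : {set T}) (r0 : T).
Hypotheses (tree : is_tree T) (r0R : r0 \in R) (R_clique : is_clique R).
Implicit Types u v x y : T.

Local Notation lev := (gdist_set R).
Local Notation par := (parent R r0).
Local Notation anc := (ancestor R r0).

Let conn : is_connected T := tree.1.

Let R_neq0 : R != set0. Proof. by apply/set0Pn; exists r0. Qed.

Lemma lev_eq0 v : (lev v == 0) = (v \in R).
Proof. exact: gdist_set_eq0. Qed.

Lemma lev_edge u v : sedge u v -> lev u <= (lev v).+1.
Proof.
move=> uv; rewrite -add1n (leq_trans (gdist_set_lip conn u v R_neq0)) //.
by rewrite leq_add2r gdist_edge.
Qed.

Lemma lev_down v : 0 < lev v -> exists2 u, sedge v u & (lev u).+1 = lev v.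
Proof.
move=> lev_v; have [r rR Er] := gdist_setP v r0R.
have neq : v != r by apply: contraTneq lev_v => ->; rewrite lt0n lev_eq0 rR.
have [u vu Eu] := gdist_step conn neq; exists u => //.
apply/eqP; rewrite eqn_leq [X in _ && X]lev_edge // andbT.
by rewrite Er Eu ltnS gdist_set_le.
Qed.

(** Descending from [u] to a root, the levels decrease strictly after [u], so
    the walk never meets [v]. *)
Lemma connect_root_avoid v u : u != v -> 0 < lev v -> lev u <= lev v ->
  exists2 r, r \in R & connect [rel x y : T | [&& x != v, y != v & sedge x y]] u r.
Proof.
move=> + lev_v; have [n] := ubnP (lev u); elim: n u => // n IH u le_n neq le_uv.
have [u0|lev_u] := posnP (lev u).
  by exists u; rewrite ?connect0 // -lev_eq0 u0.
have [x ux Ex] := lev_down lev_u.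
have neq_x : x != v by apply: contraTneq le_uv => <-; rewrite -ltnNge -Ex.
have [|||r rR con] := IH x => //; try lia.
by exists r => //; apply: connect_trans con; apply: connect1; rewrite /= neq neq_x.
Qed.

(** Two such neighbors would both be connected to the roots, hence to each
    other, without passing through [v]. *)
Lemma low_neighbor_uniq v u1 u2 : 0 < lev v -> sedge v u1 -> sedge v u2 ->
  lev u1 <= lev v -> lev u2 <= lev v -> u1 = u2.
Proof.
move=> lev_v vu1 vu2 le1 le2; apply: (tree_acyclic tree vu1 vu2).
have neq x : sedge v x -> x != v.
  by move=> vx; apply: contraTneq vx => ->; rewrite sedge_irrefl.
set e := rel_of_simpl _.
have e_sym : connect_sym e.
  by apply: sym_connect_sym => x y; rewrite /e /= sedge_sym andbCA.
have [r1 r1R con1] := connect_root_avoid (neq _ vu1) lev_v le1.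
have [r2 r2R con2] := connect_root_avoid (neq _ vu2) lev_v le2.
apply: connect_trans con1 _; rewrite e_sym; apply: connect_trans con2 _.
have [->|neq12] := eqVneq r2 r1; first exact: connect0.
have neqv r : r \in R -> r != v by rewrite -lev_eq0; apply: contraTneq => ->; lia.
by apply: connect1; rewrite /e /= !neqv // R_clique.
Qed.

Lemma parentP v : 0 < lev v -> sedge v (par v) /\ (lev (par v)).+1 = lev v.
Proof.
move=> lev_v; rewrite /parent; have [u vu Eu] := lev_down lev_v.
case: pickP => [x /andP[vx lt_x]|/(_ u)] /=; last by rewrite vu -Eu leqnn.
by split=> //; have := lev_edge vx; lia.
Qed.

Lemma lev_parent v : 0 < lev v -> (lev (par v)).+1 = lev v.
Proof. by case/parentP. Qed.

Lemma parent_root v : v \in R -> par v = r0.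
Proof.
by rewrite -lev_eq0 /parent => /eqP lev_v; case: pickP => //= u; rewrite lev_v ltn0 andbF.
Qed.

Lemma parent_uniq v u : 0 < lev v -> sedge v u -> lev u <= lev v -> par v = u.
Proof.
move=> lev_v vu le_uv; have [vp Ep] := parentP lev_v.
by apply: low_neighbor_uniq vp vu _ le_uv => //; rewrite -Ep.
Qed.

Variant edge_spec u v : Prop :=
  | EdgeUp of (lev v).+1 = lev u & par u = v
  | EdgeDown of (lev u).+1 = lev v & par v = u
  | EdgeRoots of u \in R & v \in R.

Lemma edgeP u v : sedge u v -> edge_spec u v.
Proof.
move=> uv; have vu : sedge v u by rewrite sedge_sym.
have [u0|lev_u] := posnP (lev u); have [v0|lev_v] := posnP (lev v).
- by apply: EdgeRoots; rewrite -lev_eq0 ?u0 ?v0.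
- have Pv : par v = u by apply: parent_uniq; rewrite ?u0.
  by apply: EdgeDown; rewrite // -{1}Pv lev_parent.
- have Pu : par u = v by apply: parent_uniq; rewrite ?v0.
  by apply: EdgeUp; rewrite // -{1}Pu lev_parent.
have [le_uv|lt_vu] := leqP (lev u) (lev v).
  have Pv : par v = u by apply: parent_uniq.
  by apply: EdgeDown; rewrite // -{1}Pv lev_parent.
have Pu : par u = v by apply: parent_uniq => //; apply: ltnW.
by apply: EdgeUp; rewrite // -{1}Pu lev_parent.
Qed.

Lemma lev_iter k v : k <= lev v -> lev (iter k par v) = lev v - k.
Proof.
elim: k => [|k IH] le_k; rewrite ?subn0 //=.
have Ek := IH (ltnW le_k).
have : 0 < lev (iter k par v) by rewrite Ek subn_gt0.
by move/lev_parent; rewrite Ek; lia.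
Qed.

Lemma lev_anc c v : c <= lev v -> lev (anc c v) = c.
Proof. by move=> le_c; rewrite /ancestor lev_iter ?leq_subr // subKn. Qed.

Lemma anc_self v : anc (lev v) v = v.
Proof. by rewrite /ancestor subnn. Qed.

Lemma anc_parent c v : c < lev v -> anc c (par v) = anc c v.
Proof.
move=> lt_c; have E : (lev (par v)).+1 = lev v by apply: lev_parent; lia.
by rewrite /ancestor -E subSn -1?ltnS ?E // iterSr.
Qed.

Lemma anc_anc c c' v : c <= c' <= lev v -> anc c (anc c' v) = anc c v.
Proof.
move=> /andP[le_c le_c']; rewrite {1}/ancestor lev_anc // /ancestor -iterD.
by congr iter; lia.
Qed.

(** The lower bound on path lengths that replaces an explicit distance formula.
    A path stays within a branch, and then it is at least as long as the detour
    over the deepest common ancestor, or it uses the edge between the roots. As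
    only a lower bound is wanted, any common ancestor that makes the inequality
    true will do, so that an induction along the path suffices. *)
Lemma tree_path_length u (p : seq T) : path sedge u p ->
  (exists c, [/\ c <= lev u, c <= lev (last u p), anc c u = anc c (last u p)
                & lev u + lev (last u p) <= size p + 2 * c])
  \/ (anc 0 u <> anc 0 (last u p) /\ lev u + lev (last u p) < size p).
Proof.
elim: p u => [|x p IH] u /=; first by move=> _; left; exists (lev u); split=> //; lia.
set v := last x p => /andP[ux /IH{IH}]; rewrite -/v.
case: (edgeP ux) => [Ex Px|Eu Pu|uR xR].
- case=> [[c [cx cv Ec le_c]]|[neq le_c]]; [left; exists c|right].
    by rewrite -(@anc_parent c u) ?Px; last lia; split=> //; lia.
  by rewrite -(@anc_parent 0 u) ?Px; last lia; split=> //; lia.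
- case=> [[c [cx cv Ec le_c]]|[neq le_c]]; last first.
    by right; rewrite -{1}Pu anc_parent; last lia; split=> //; lia.
  have [le_cu|lt_uc] := leqP c (lev u).
    left; exists c; rewrite -{2}Pu anc_parent ?Pu; last lia.
    by split=> //; lia.
  (* The common ancestor of [x] and [v] is [x] itself; its parent [u] serves instead. *)
  left; exists (lev u); have cE : c = (lev u).+1 by lia.
  have -> : anc (lev u) v = anc (lev u) x.
    by rewrite -(@anc_anc (lev u) c v) -?Ec ?anc_anc //; lia.
  by rewrite -(@anc_parent (lev u) x) ?Pu; last lia; split=> //; lia.
- have /eqP u0 : lev u == 0 by rewrite lev_eq0.
  have /eqP x0 : lev x == 0 by rewrite lev_eq0.
  have [Eav|neqv] := eqVneq (anc 0 u) (anc 0 v); last first.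
    move=> H; right; split; first exact/eqP.
    by case: H => [[c [cx cv Ec le_c]]|[neq le_c]]; lia.
  move=> H; left; exists 0; split=> //.
  by case: H => [[c [cx cv Ec le_c]]|[neq le_c]]; lia.
Qed.

Lemma tree_dist u v :
  (exists c, [/\ c <= lev u, c <= lev v, anc c u = anc c v
                & lev u + lev v <= gdist u v + 2 * c])
  \/ (anc 0 u <> anc 0 v /\ lev u + lev v < gdist u v).
Proof.
by have [p [up <- <-]] := gdist_path conn u v; apply: tree_path_length.
Qed.

Lemma gdist_iter k v : k <= lev v -> gdist v (iter k par v) <= k.
Proof.
elim: k => [|k IH] le_k; first by rewrite gdist_xx.
rewrite (leq_trans (gdist_triangle conn (iter k par v) _ _)) // -[X in _ <= X]addn1 leq_add ?IH //.
  exact: ltnW.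
by rewrite /= gdist_edge //; case: (@parentP (iter k par v)) => //; rewrite lev_iter; lia.
Qed.

Lemma gdist_anc c v : gdist v (anc c v) <= lev v - c.
Proof. by rewrite gdist_iter ?leq_subr. Qed.

Lemma degree_lev_gt0 v : 0 < lev v -> degree v = #|children R r0 v|.+1.
Proof.
move=> lev_v; have [vp Ep] := parentP lev_v; rewrite /degree.
suff -> : [set u | sedge v u] = par v |: children R r0 v.
  by rewrite cardsU1 inE -Ep; case: eqP => //; lia.
apply/setP=> u; rewrite !inE; apply/idP/predU1P=> [vu|[-> //|/andP[/eqP Eu /eqP <-]]].
  case: (edgeP vu) => [_ ->|-> ->|]; [by left | by right; rewrite !eqxx|].
  by rewrite -!lev_eq0; lia.
by rewrite sedge_sym; case: (@parentP u) => //; rewrite Eu.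
Qed.

Lemma degree_root v : v \in R -> degree v = #|children R r0 v| + #|R|.-1.
Proof.
move=> vR; rewrite /degree; have /eqP v0 : lev v == 0 by rewrite lev_eq0.
suff -> : [set u | sedge v u] = (R :\ v) :|: children R r0 v.
  rewrite cardsU (_ : _ :&: _ = set0) ?cards0 ?subn0.
    by rewrite (cardsD1 v R) vR addnC.
  by apply/setP=> u; rewrite !inE v0 -lev_eq0; case: (lev u) => [|n]; rewrite ?andbF.
apply/setP=> u; rewrite !inE; apply/idP/idP=> [vu|].
  have neq : u != v by apply: contraTneq vu => ->; rewrite sedge_irrefl.
  case: (edgeP vu) => [|-> ->|_ uR]; first by rewrite v0.
    by rewrite !eqxx orbT.
  by rewrite neq uR.
case/orP=> [/andP[neq uR]|/andP[/eqP Eu /eqP <-]].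
  by rewrite R_clique // eq_sym.
by rewrite sedge_sym; case: (@parentP u) => //; rewrite Eu.
Qed.

End RootedTree.

(** * Level sizes and the order of the vertices of a level-wise regular tree *)

Section LevelSize.
Variables (q : nat) (ch : nat -> nat).

(** The number of vertices on level [t], when there are [q] roots and every
    vertex on level [j] has [ch j] children. *)
Definition level_size (t : nat) : nat := q * \prod_(0 <= j < t) ch j.

(** The number of vertices on the levels from 1 to [t - 1]. Level 0 is left out
    as only vertices outside the root set are placed by means of it. *)
Definition level_offset (t : nat) : nat := \sum_(1 <= s < t) level_size s.

Lemma level_sizeS t : level_size t.+1 = level_size t * ch t.
Proof. by rewrite /level_size big_nat_recr //= mulnA. Qed.

Lemma level_sizeD s t : s <= t ->
  level_size t = level_size s * \prod_(s <= j < t) ch j.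
Proof. by move=> le_st; rewrite /level_size -mulnA -big_cat_nat. Qed.

Lemma level_offsetD s t : 1 <= s <= t ->
  level_offset t = level_offset s + \sum_(s <= j < t) level_size j.
Proof. by case/andP=> s1 st; rewrite /level_offset -big_cat_nat. Qed.

Lemma level_offsetS t : 0 < t -> level_offset t.+1 = level_offset t + level_size t.
Proof. by move=> t_gt0; rewrite /level_offset big_nat_recr. Qed.

Lemma level_offset_le s t : s <= t -> level_offset s <= level_offset t.
Proof.
case: s => [|s] le_st; first by rewrite /level_offset big_geq.
by rewrite (@level_offsetD s.+1 t) ?leq_addr.
Qed.

Lemma level_offset_mod c s t : 1 <= s -> c <= s <= t ->
  level_offset t = level_offset s %[mod level_size c].
Proof.
move=> s1 /andP[cs st]; rewrite (@level_offsetD s t) ?s1 //.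
apply/eqP; rewrite -[X in _ == X %[mod _]]addn0 eqn_modDl mod0n -/(dvdn _ _) big_nat.
apply: dvdn_sum => j /andP[sj _]; rewrite (@level_sizeD c j); last exact: leq_trans sj.
by rewrite dvdn_mulr.
Qed.

End LevelSize.

Lemma mixed_radix_inj N i i' p p' : p < N -> p' < N -> p + N * i = p' + N * i' ->
  p = p' /\ i = i'.
Proof.
move=> ltp ltp' E; have N0 : 0 < N by lia.
have := congr1 (modn^~ N) E; rewrite /= ![_ + N * _]addnC ![N * _]mulnC !modnMDl !modn_small //.
move=> pp'; split=> //; move: E; rewrite pp' => /addnI /eqP.
by rewrite eqn_pmul2l // => /eqP.
Qed.

Section Numbering.
Variables (T : sgraph) (R : {set T}) (r0 : T) (h : nat) (ch : nat -> nat).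
Hypotheses (tree : is_tree T) (r0R : r0 \in R).

Local Notation lev := (gdist_set R).
Local Notation par := (parent R r0).
Local Notation anc := (ancestor R r0).
Local Notation N := (level_size #|R| ch).
Local Notation offset := (level_offset #|R| ch).
Implicit Types u v x y : T.

Hypothesis lev_le : forall v, lev v <= h.
Hypothesis children_card : forall v, lev v < h -> #|children R r0 v| = ch (lev v).

Let lev_par := lev_parent tree r0R.

Lemma child_parent v : 0 < lev v -> v \in children R r0 (par v).
Proof. by move=> /lev_par E; rewrite inE E !eqxx. Qed.

(** A mixed radix number: the digits of [v] are the indices of the vertices on the
    path from the root to [v] among their siblings, and the digit nearest to the
    root is the least significant one. Thus the position of [v] modulo the size
    of level [c] depends only on the ancestor on level [c], and consecutive
    positions run cyclically through the branches. *)
Fixpoint position_rec (k : nat) (v : T) : nat :=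
  if k is k'.+1 then
    position_rec k' (par v) + N k' * index v (enum (children R r0 (par v)))
  else index v (enum R).

Definition position v := position_rec (lev v) v.

Lemma position_parent v : 0 < lev v ->
  position v = position (par v)
    + N (lev (par v)) * index v (enum (children R r0 (par v))).
Proof. by move=> /lev_par E; rewrite /position -E. Qed.

Lemma index_children v : 0 < lev v ->
  index v (enum (children R r0 (par v))) < ch (lev (par v)).
Proof.
move=> lev_v; have lt_h : lev (par v) < h by have := lev_par lev_v; have := lev_le v; lia.
by rewrite -children_card // cardE index_mem mem_enum child_parent.
Qed.

Lemma position_lt v : position v < N (lev v).
Proof.
have [n] := ubnP (lev v); elim: n v => // n IH v le_n.
have [v0|lev_v] := posnP (lev v).
  have /eqP := v0; rewrite (lev_eq0 tree r0R) => vR.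
  by rewrite /position v0 /level_size big_geq // muln1 cardE index_mem mem_enum.
have lt_n : lev (par v) < n by have := lev_par lev_v; lia.
have := IH (par v) lt_n; have := index_children lev_v; have := lev_par lev_v.
rewrite (position_parent lev_v) => <-; rewrite level_sizeS.
move: (index _ _) (position _) (N _) (ch _) => i p M c lt_ic lt_pM.
by apply: (@leq_trans (M + M * i)); rewrite ?ltn_add2r // -mulnS leq_mul2l lt_ic orbT.
Qed.

Lemma position_inj u v : lev u = lev v -> position u = position v -> u = v.
Proof.
have [n] := ubnP (lev u); elim: n u v => // n IH u v le_n Elev.
have [u0|lev_u] := posnP (lev u).
  have := u0; have := u0; rewrite {1}Elev => /eqP + /eqP.
  rewrite !(lev_eq0 tree r0R) => vR uR.
  rewrite /position -Elev u0 /= => /(congr1 (nth u (enum R))).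
  by rewrite !nth_index ?mem_enum.
have lev_v : 0 < lev v by rewrite -Elev.
have Ep : lev (par u) = lev (par v).
  by apply: succn_inj; rewrite !lev_par.
rewrite (position_parent lev_u) (position_parent lev_v) Ep => /mixed_radix_inj[].
- by rewrite -Ep position_lt.
- exact: position_lt.
move=> Epos Eidx; have Epar : par u = par v.
  by apply: IH => //; have := lev_par lev_u; lia.
move: Eidx; rewrite Epar => /(congr1 (nth u (enum (children R r0 (par v))))).
by rewrite !nth_index ?mem_enum ?child_parent // -Epar child_parent.
Qed.

Lemma position_mod c v : c <= lev v -> position v = position (anc c v) %[mod N c].
Proof.
have [n] := ubnP (lev v); elim: n v => // n IH v le_n le_c.
have [Ec|lt_c] := eqVneq c (lev v); first by rewrite Ec anc_self.
have lev_v : 0 < lev v by lia.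
have Ep := lev_par lev_v.
rewrite -(@anc_parent _ _ _ tree r0R c v); last lia.
rewrite -IH; [|lia|lia]; rewrite (position_parent lev_v).
rewrite (@level_sizeD _ _ c (lev (par v))); last lia.
by rewrite -mulnA addnC mulnC modnMDl.
Qed.

Lemma card_level_anc a t : lev a <= t <= h ->
  #|[set v | (lev v == t) && (anc (lev a) v == a)]| = \prod_(lev a <= j < t) ch j.
Proof.
have base : #|[set v | (lev v == lev a) && (anc (lev a) v == a)]| = 1.
  rewrite -(cards1 a); apply: eq_card => v; rewrite !inE.
  by apply/andP/eqP=> [[/eqP <- /eqP <-]|->]; rewrite ?anc_self ?eqxx.
case/andP=> le_at; rewrite -(subnKC le_at); move: (t - lev a) => {t le_at} k.
elim: k => [|k IH]; first by rewrite addn0 big_geq.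
rewrite addnS => lt_h.
set t := lev a + k in IH lt_h *; have le_at : lev a <= t := leq_addr _ _.
rewrite big_nat_recr //= -IH 1?ltnW // -!sum1_card.
rewrite (partition_big par (mem [set v | (lev v == t) && (anc (lev a) v == a)])) /=.
  rewrite [RHS]mulnC big_distrr /=; apply: eq_bigr => v.
  rewrite inE muln1 => /andP[/eqP Ev /eqP Ea].
  rewrite -Ev -children_card ?Ev // sum1dep_card; apply: eq_card => u; rewrite !inE Ev.
  apply/andP/andP=> [[/andP[-> _] ->] //|[/eqP Eu /eqP Epu]]; split=> //.
    by rewrite Eu eqxx /= -(anc_parent tree r0R) ?Epu ?Ea // Eu ltnS.
  by rewrite Epu.
move=> u; rewrite !inE => /andP[/eqP Eu /eqP Ea].
have Ep : (lev (par u)).+1 = lev u by apply: lev_par; rewrite Eu.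
by rewrite (anc_parent tree r0R) ?Ea ?eqxx ?andbT; lia.
Qed.

Lemma card_level t : t <= h -> #|[set v | lev v == t]| = N t.
Proof.
move=> le_th; rewrite -sum1_card (partition_big (anc 0) (mem R)) /=.
  rewrite /level_size -sum_nat_const; apply: eq_bigr => a aR.
  have /eqP a0 : lev a == 0 by rewrite (lev_eq0 tree r0R).
  have := @card_level_anc a t; rewrite a0 => <- //.
  by rewrite sum1dep_card; apply: eq_card => v; rewrite !inE.
by move=> v _; rewrite -(lev_eq0 tree r0R) (lev_anc tree r0R).
Qed.

Lemma sum_by_level (P : pred T) (F : T -> nat) :
  \sum_(v | P v) F v = \sum_(0 <= t < h.+1) \sum_(v | P v && (lev v == t)) F v.
Proof.
rewrite (partition_big (fun v => inord (lev v) : 'I_h.+1) predT) //= big_mkord.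
apply: eq_bigr => t _; apply: eq_bigl => v.
by rewrite -val_eqE /= inordK // ltnS.
Qed.

Lemma sum_lev (F : nat -> nat) :
  \sum_(v : T) F (lev v) = \sum_(0 <= t < h.+1) N t * F t.
Proof.
rewrite (sum_by_level predT) big_nat [RHS]big_nat; apply: eq_bigr => t /= le_t.
rewrite -card_level; last lia.
rewrite -sum1_card big_distrl /=; apply: eq_big => [v|v /eqP->]; first by rewrite inE.
by rewrite mul1n.
Qed.

Lemma card_branch a : lev a <= h ->
  #|[set v | (lev a <= lev v) && (anc (lev a) v == a)]| =
  \sum_(lev a <= t < h.+1) \prod_(lev a <= j < t) ch j.
Proof.
move=> le_a; rewrite -sum1dep_card sum_by_level (big_cat_nat _ (n := lev a)) //=; last lia.
rewrite big_nat big1 ?add0n => [|t]; last first.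
  move=> lt_t; apply: big_pred0 => v; case: (lev v =P t) => [->|_]; rewrite ?andbF //.
  by rewrite leqNgt; case/andP: lt_t => _ ->.
rewrite big_nat [RHS]big_nat; apply: eq_bigr => t /andP[le_at lt_th].
rewrite -card_level_anc ?le_at // sum1dep_card; apply: eq_card => v; rewrite !inE.
by case: (lev v =P t) => [->|_]; rewrite ?andbF // le_at andbT.
Qed.

Lemma card_nonroot : #|[set v | 0 < lev v]| = offset h.+1.
Proof.
rewrite -sum1dep_card sum_by_level big_ltn // big_pred0 ?add0n => [|v]; last by case: (lev v).
rewrite /level_offset big_nat [RHS]big_nat; apply: eq_bigr => t /andP[t0 th].
rewrite -card_level // sum1dep_card; apply: eq_card => v; rewrite !inE.
by case: eqP => [->|_]; rewrite ?andbF ?t0.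
Qed.

(** The vertices outside the root set are ordered level by level and by position
    within a level, but the vertex of level 1 and position 0 goes to the end,
    so that the last vertex has level 1 as well. The place 0 that becomes free is
    left to the roots. *)
Definition rank v : nat :=
  if lev v == 0 then 0
  else if (lev v == 1) && (position v == 0) then offset h.+1
  else offset (lev v) + position v.

Hypotheses (h_gt0 : 0 < h) (N1_gt1 : 1 < N 1).

Let offset1 : offset 1 = 0. Proof. by rewrite /level_offset big_geq. Qed.

Lemma rank_plain v : 0 < lev v -> (lev v == 1) && (position v == 0) = false ->
  [/\ rank v = offset (lev v) + position v, 0 < rank v & rank v < offset h.+1].
Proof.
move=> lev_v plain; rewrite /rank plain -leqn0 leqNgt lev_v /=.
have := position_lt v; have := lev_le v.
have := level_offsetS #|R| ch lev_v; split=> //; last first.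
  by have := @level_offset_le #|R| ch (lev v).+1 h.+1; lia.
have [v1|neq] := eqVneq (lev v) 1; first by move: plain; rewrite v1; lia.
have := @level_offset_le #|R| ch 2 (lev v); rewrite level_offsetS //; lia.
Qed.

Lemma rank_special v : lev v = 1 -> position v = 0 -> rank v = offset h.+1.
Proof. by rewrite /rank => -> ->. Qed.

Let offset_max_gt1 : 1 < offset h.+1.
Proof. by have := @level_offset_le #|R| ch 2 h.+1; rewrite level_offsetS //; lia. Qed.

Lemma rank_range v : 0 < lev v -> 0 < rank v <= offset h.+1.
Proof.
move=> lev_v; case E: ((lev v == 1) && (position v == 0)).
  by case/andP: E => /eqP v1 /eqP p0; rewrite rank_special // leqnn andbT; lia.
by have [_ -> /ltnW->] := rank_plain lev_v E.
Qed.

Lemma rank_inj u v : 0 < lev u -> 0 < lev v -> rank u = rank v -> u = v.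
Proof.
move=> lev_u lev_v.
case Eu: ((lev u == 1) && (position u == 0)); case Ev: ((lev v == 1) && (position v == 0)).
- case/andP: Eu => /eqP u1 /eqP pu; case/andP: Ev => /eqP v1 /eqP pv _.
  by apply: position_inj; rewrite ?u1 ?pu.
- case/andP: Eu => /eqP u1 /eqP pu; have [_ _] := rank_plain lev_v Ev.
  by rewrite (rank_special u1 pu); lia.
- case/andP: Ev => /eqP v1 /eqP pv; have [_ _] := rank_plain lev_u Eu.
  by rewrite (rank_special v1 pv); lia.
have [-> _ _] := rank_plain lev_u Eu; have [-> _ _] := rank_plain lev_v Ev.
have := position_lt u; have := position_lt v.
have := level_offsetS #|R| ch lev_u; have := level_offsetS #|R| ch lev_v.
have [lt|lt|E] := ltngtP (lev u) (lev v).
- by have := level_offset_le #|R| ch lt; lia.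
- by have := level_offset_le #|R| ch lt; lia.
by move=> _ _ _ _; rewrite E => /addnI; apply: position_inj.
Qed.

(** The levels from [c] on have sizes divisible by [N c], so the ranks respect
    the residues of the positions. For the vertex moved to the end this holds
    since the total [offset h.+1] is divisible by [N 1] and by [N 0]. *)
Lemma rank_mod c v : 0 < lev v -> c <= lev v ->
  rank v = offset (maxn c 1) + position (anc c v) %[mod N c].
Proof.
move=> lev_v le_c; case E: ((lev v == 1) && (position v == 0)).
  case/andP: E => /eqP v1 /eqP pv; rewrite (rank_special v1 pv).
  have -> : maxn c 1 = 1 by lia.
  rewrite -modnDmr -position_mod // modnDmr pv addn0.
  by apply: level_offset_mod; lia.
have [-> _ _] := rank_plain lev_v E.
rewrite -modnDmr position_mod // modnDmr -modnDml.
by rewrite (@level_offset_mod _ _ c (maxn c 1)) ?modnDml //; lia.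
Qed.

(** Vertices with a common ancestor on level [c] have different but congruent
    ranks modulo [N c]. *)
Lemma rank_gap c u v : 0 < lev u -> 0 < lev v -> c <= lev u -> c <= lev v ->
  anc c u = anc c v -> rank u < rank v -> N c <= rank v - rank u.
Proof.
move=> lev_u lev_v cu cv Ec lt_uv; apply: dvdn_leq; first by rewrite subn_gt0.
by rewrite -eqn_mod_dvd ?(ltnW lt_uv) // !(@rank_mod c) // Ec.
Qed.

Lemma rank_first v : 0 < lev v -> rank v = 1 -> lev v = 1.
Proof.
move=> lev_v; case E: ((lev v == 1) && (position v == 0)).
  by case/andP: E => /eqP.
have [-> _ _] := rank_plain lev_v E.
by have := @level_offset_le #|R| ch 2 (lev v); rewrite level_offsetS //; lia.
Qed.

Lemma rank_last v : 0 < lev v -> rank v = offset h.+1 -> lev v = 1.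
Proof.
move=> lev_v; case E: ((lev v == 1) && (position v == 0)).
  by case/andP: E => /eqP.
by have [_ _] := rank_plain lev_v E; lia.
Qed.

End Numbering.

(** * Line graphs of rooted trees *)

Section LineGraph.
Variable T : sgraph.
Hypothesis conn : is_connected T.
Implicit Types (e f : line_graph T) (x y : T).

Lemma line_vertexP e : exists x y, sedge x y /\ val e = [set x; y].
Proof.
have := valP e; rewrite inE => /existsP[x /existsP[y /andP[xy /eqP E]]].
by exists x, y.
Qed.

Lemma line_vertex_ex x y : sedge x y -> exists e, val e = [set x; y].
Proof.
move=> xy; have eP : [set x; y] \in edge_set T.
  by rewrite inE; apply/existsP; exists x; apply/existsP; exists y; rewrite xy eqxx.
by exists (Sub [set x; y] eP).
Qed.

Lemma line_vertex_dist e x y : x \in val e -> y \in val e -> gdist x y <= 1.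
Proof.
have [a [b [ab ->]]] := line_vertexP e; have ba : sedge b a by rewrite sedge_sym.
by rewrite !inE => /orP[]/eqP-> /orP[]/eqP->; rewrite ?gdist_xx ?gdist_edge.
Qed.

Lemma line_share_edge e f x : e != f -> x \in val e -> x \in val f -> sedge e f.
Proof.
move=> neq xe xf; apply/andP; split=> //.
by apply/set0Pn; exists x; rewrite inE xe.
Qed.

(** Each edge of the tree path, put after [e], is adjacent to or equal to the one
    before it; finally [f] is appended. *)
Lemma line_walk (p : seq T) e f x : path sedge x p -> x \in val e -> last x p \in val f ->
  exists q : seq (line_graph T),
    [/\ path sedge e q, last e q = f & size q <= (size p).+1].
Proof.
elim: p x e => [|y p IH] x e /=.
  move=> _ xe xf; have [->|neq] := eqVneq e f; first by exists [::].
  by exists [:: f]; split=> //; apply/andP; split=> //; apply: line_share_edge neq xe xf.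
case/andP=> xy yp xe lf; have [e' Ee'] := line_vertex_ex xy.
have [xe' ye'] : x \in val e' /\ y \in val e' by rewrite Ee' !inE !eqxx orbT.
have [q [e'q lq szq]] := IH y e' yp ye' lf.
have [->|neq] := eqVneq e e'; first by exists q; split=> //; apply: leqW.
exists (e' :: q); split=> //; apply/andP; split=> //.
exact: line_share_edge neq xe xe'.
Qed.

Lemma line_gdist_le e f x y : x \in val e -> y \in val f -> gdist e f <= (gdist x y).+1.
Proof.
move=> xe; have [p [xp <- <-]] := gdist_path conn x y => lf.
have [q [eq <- szq]] := line_walk xp xe lf.
by apply: leq_trans szq; apply: gdist_le_path.
Qed.

Lemma line_connected : is_connected (line_graph T).
Proof.
apply/forall_inP=> e _; apply/forall_inP=> f _.
have [x [x' [_ Ee]]] := line_vertexP e; have [y [y' [_ Ef]]] := line_vertexP f.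
have [p [xp lp _]] := gdist_path conn x y.
have [||q [eq <- _]] := @line_walk p e f x xp; first by rewrite Ee !inE eqxx.
  by rewrite lp Ef !inE eqxx.
apply/connectP; exists q => //.
by apply: sub_path eq => a b ab; apply/and3P; rewrite !in_setT.
Qed.

Lemma gdist_le_line e f x y : x \in val e -> y \in val f -> gdist x y <= (gdist e f).+1.
Proof.
move=> + yf; have [q [eq lq <-]] := gdist_path line_connected e f.
elim: q e x eq lq => [|e' q IH] e x /=.
  by move=> _ -> xf; apply: line_vertex_dist xf yf.
case/andP=> /andP[_ /set0Pn[z]]; rewrite inE => /andP[ze ze'] e'q lq xe.
rewrite (leq_trans (gdist_triangle conn z _ _)) // -[X in _ <= X]add1n.
by rewrite leq_add ?(line_vertex_dist xe ze) // (IH e').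
Qed.

End LineGraph.

(** The end vertex of [e] farther from [r0]; it determines [e]. *)
Definition lower_end (T : sgraph) (R : {set T}) (r0 : T) (e : line_graph T) : T :=
  odflt r0 [pick v | (v != r0) && (val e == [set v; parent R r0 v])].

Section RootedLineGraph.
Variables (T : sgraph) (R : {set T}) (r0 : T).
Hypotheses (tree : is_tree T) (r0R : r0 \in R) (R_clique : is_clique R).
Hypothesis R_le2 : #|R| <= 2.
Implicit Types (e f : line_graph T) (u v x y : T).

Local Notation lev := (gdist_set R).
Local Notation par := (parent R r0).
Local Notation anc := (ancestor R r0).
Local Notation low := (lower_end R r0).

Lemma parent_edge v : v != r0 -> sedge v (par v).
Proof.
move=> neq; have [v0|lev_v] := posnP (lev v); last by case: (parentP tree r0R lev_v).
have /eqP := v0; rewrite (lev_eq0 tree r0R) => vR.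
by rewrite (parent_root tree r0R) ?R_clique.
Qed.

Lemma parent_asym u v : u != r0 -> par u = v -> par v = u -> v = r0.
Proof.
move=> neq Pu Pv; have [v0|lev_v] := posnP (lev v).
  have /eqP := v0; rewrite (lev_eq0 tree r0R) => /(parent_root tree r0R).
  by rewrite Pv => E; rewrite E eqxx in neq.
have Ev := lev_parent tree r0R lev_v; rewrite Pv in Ev.
have [u0|lev_u] := posnP (lev u).
  have /eqP := u0; rewrite (lev_eq0 tree r0R) => /(parent_root tree r0R).
  by rewrite Pu.
have := lev_parent tree r0R lev_u; rewrite Pu; lia.
Qed.

(** For an edge between two roots, one of them is [r0], as there are at most two
    roots, and [r0] is the parent of the other one. *)
Lemma edge_parent u v : sedge u v -> (u != r0 /\ par u = v) \/ (v != r0 /\ par v = u).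
Proof.
have root_neq x y : (lev x).+1 = lev y -> y != r0.
  by move=> E; apply: contraTneq r0R => <-; rewrite -(lev_eq0 tree r0R) -E.
move=> uv; case: (edgeP tree r0R R_clique uv) => [E P|E P|uR vR].
- by left; split=> //; apply: root_neq E.
- by right; split=> //; apply: root_neq E.
have neq : u != v by apply: contraTneq uv => ->; rewrite sedge_irrefl.
have [ur|nur] := eqVneq u r0.
  by right; rewrite (parent_root tree r0R) // -{1}ur eq_sym.
have [vr|nvr] := eqVneq v r0; first by left; rewrite (parent_root tree r0R) // -vr.
have : u |: [set v; r0] \subset R.
  by apply/subsetP=> x; rewrite !inE => /or3P[]/eqP->.
move/subset_leq_card; rewrite cardsU1 cards2 !inE negb_or neq nur nvr /=.
by move/leq_trans/(_ R_le2).
Qed.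

Lemma lower_endP e : low e != r0 /\ val e = [set low e; par (low e)].
Proof.
rewrite /lower_end; case: pickP => [v /andP[neq /eqP E] //|none] /=.
have [x [y [xy E]]] := line_vertexP e.
have [[neq Px]|[neq Py]] := edge_parent xy.
  by have := none x; rewrite neq Px E eqxx.
by have := none y; rewrite neq Py E setUC eqxx.
Qed.

Lemma lower_end_mem e : low e \in val e.
Proof. by have [_ ->] := lower_endP e; rewrite !inE eqxx. Qed.

Lemma parent_mem e : par (low e) \in val e.
Proof. by have [_ ->] := lower_endP e; rewrite !inE eqxx orbT. Qed.

Lemma lower_end_inj : injective low.
Proof.
move=> e f Elow; apply: val_inj.
by have [_ ->] := lower_endP e; have [_ ->] := lower_endP f; rewrite Elow.
Qed.

Lemma lower_end_onto v : v != r0 -> exists e, low e = v.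
Proof.
move=> neq; have [e Ee] := line_vertex_ex (parent_edge neq); exists e.
have [neq' Ee'] := lower_endP e.
have := lower_end_mem e; rewrite Ee !inE => /orP[/eqP //|/eqP Elow].
have : v \in val e by rewrite Ee !inE eqxx.
rewrite Ee' !inE => /orP[/eqP-> //|/eqP Ev].
by have := parent_asym neq (esym Elow) (esym Ev); move/eqP; rewrite (negPf neq').
Qed.

Lemma lower_end_image (P : pred T) :
  [set low e | e in [pred e | P (low e)]] = [set v | (v != r0) && P v].
Proof.
apply/setP=> v; rewrite inE; apply/imsetP/andP=> [[e Pe ->]|[neq Pv]].
  by have [neq _] := lower_endP e.
by have [e Ee] := lower_end_onto neq; exists e; rewrite // inE Ee.
Qed.

Lemma card_lower_end (P : pred T) : #|[set e | P (low e)]| = #|[set v | (v != r0) && P v]|.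
Proof.
rewrite -lower_end_image card_imset; last exact: lower_end_inj.
by apply: eq_card => e; rewrite inE.
Qed.

Lemma sum_lower_end (F : T -> nat) : \sum_(e : line_graph T) F (low e) = \sum_(v | v != r0) F v.
Proof.
rewrite -(big_imset F (h := low) (A := predT)) /=; last first.
  by move=> e f _ _; apply: lower_end_inj.
apply: eq_bigl => v; apply/imsetP/idP=> [[e _ ->]|/lower_end_onto[e <-]].
  by case: (lower_endP e).
by exists e.
Qed.

Lemma line_sedgeE e f : sedge e f =
  (low e != low f) && [|| low e == par (low f), par (low e) == low f | par (low e) == par (low f)].
Proof.
have -> : sedge e f = (e != f) && (val e :&: val f != set0) by [].
rewrite (inj_eq lower_end_inj); case: eqVneq => //= neq.
have [_ Ee] := lower_endP e; have [_ Ef] := lower_endP f.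
have neq' : low e != low f by rewrite (inj_eq lower_end_inj).
apply/set0Pn/or3P=> [[x]|[]/eqP E]; last 3 first.
- by exists (low e); rewrite inE lower_end_mem Ef !inE E eqxx orbT.
- by exists (low f); rewrite inE lower_end_mem Ee !inE E eqxx orbT.
- by exists (par (low e)); rewrite inE parent_mem E parent_mem.
rewrite Ee Ef !inE => /andP[/orP[]/eqP-> /orP[]/eqP E].
- by rewrite E eqxx in neq'.
- by apply: Or31; rewrite E.
- by apply: Or32; rewrite E.
- by apply: Or33; rewrite E.
Qed.

End RootedLineGraph.

(** * Line graphs of trees are block graphs *)

(** For this purpose the tree is rooted at an arbitrary single vertex [r0]. *)
Section BlockGraph.
Variables (T : sgraph) (r0 : T).
Hypothesis tree : is_tree T.

Local Notation R := [set r0].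
Local Notation lev := (gdist_set R).
Local Notation par := (parent R r0).
Local Notation anc := (ancestor R r0).
Local Notation low := (lower_end R r0).
Implicit Types (e f x y z : line_graph T) (S : {set line_graph T}).

Let r0R : r0 \in R. Proof. exact: set11. Qed.
Let R_clique : is_clique R.
Proof. by move=> x y; rewrite !inE => /eqP-> /eqP->; rewrite eqxx. Qed.
Let R_le2 : #|R| <= 2. Proof. by rewrite cards1. Qed.

Let lev_low e : 0 < lev (low e).
Proof.
rewrite lt0n (lev_eq0 tree r0R) inE.
by case: (lower_endP tree r0R R_clique R_le2 e).
Qed.

Let low_inj := lower_end_inj tree r0R R_clique R_le2.
Let sedgeE := line_sedgeE tree r0R R_clique R_le2.

(** [u] lies on the path from [v] to the root; it may be equal to [v]. *)
Definition above (u v : T) : bool := (lev u <= lev v) && (anc (lev u) v == u).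

Lemma above_parent u v : 0 < lev v -> u != v -> above u v = above u (par v).
Proof.
move=> lev_v neq; have Ev := lev_parent tree r0R lev_v.
have [lt|le] := ltnP (lev (par v)) (lev u); last first.
  by rewrite /above le -Ev leqW // (anc_parent tree r0R) // -Ev ltnS.
rewrite {2}/above leqNgt lt /=; apply/negbTE/negP=> /andP[le /eqP E].
have Euv : lev u = lev v by lia.
by move: E; rewrite Euv anc_self => E; rewrite E eqxx in neq.
Qed.

Lemma connect_in_inv S x y (P : pred (line_graph T)) :
    connect [rel u v | [&& u \in S, v \in S & sedge u v]] x y ->
    (forall u v, u \in S -> v \in S -> sedge u v -> P u -> P v) ->
  P x -> P y.
Proof.
case/connectP=> p path_p -> step; elim: p x path_p => //= z p IH x.
by case/andP=> /and3P[xS zS xz] pz Px; apply: IH pz _; apply: step Px.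
Qed.

(** Among the edges other than [x], those below [x] and those not below [x] are
    never adjacent: the former lie in the subtree under the lower end of [x],
    and only [x] joins this subtree to the rest of the tree. *)
Lemma above_step S x u v : u \in S :\ x -> v \in S :\ x -> sedge u v ->
  above (low x) (low u) -> above (low x) (low v).
Proof.
rewrite !inE => /andP[nux _] /andP[nvx _]; rewrite sedgeE => /andP[_].
have nx (w : line_graph T) : w != x -> low x != low w.
  by rewrite eq_sym (inj_eq low_inj).
rewrite (above_parent (lev_low u)) ?nx //.
case/or3P=> [/eqP E|/eqP->//|/eqP ->].
  rewrite -(above_parent (lev_low u)) ?nx // E.
  by rewrite -(above_parent (lev_low v)) ?nx.
by rewrite -(above_parent (lev_low v)) ?nx.
Qed.

(** Adjacent edges neither of which is above the other have the same upper end,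
    and this is inherited along walks. *)
Lemma antichain_same_parent S x y : connected_in S -> x \in S -> y \in S ->
    (forall u v, u \in S -> v \in S -> u != v -> ~~ above (low u) (low v)) ->
  par (low x) = par (low y).
Proof.
move=> /forall_inP/(_ x) connS xS yS anti.
have /forall_inP/(_ y yS) con := connS xS.
apply/eqP; apply: (connect_in_inv (P := fun z => par (low x) == par (low z)) con) => //.
move=> u v uS vS uv /eqP->; move: uv; rewrite sedgeE => /andP[nuv].
have above_par w : above (par (low w)) (low w).
  by rewrite above_parent ?lev_low // /above ?leqnn ?anc_self ?eqxx //;
     apply/eqP=> E; have := lev_parent tree r0R (lev_low w); rewrite E; lia.
have nuv' : u != v by apply: contraNneq nuv => ->.
have nvu' : v != u by rewrite eq_sym.
case/or3P=> // /eqP E.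
  by have := anti u v uS vS nuv'; rewrite E above_par.
by have := anti v u vS uS nvu'; rewrite -E above_par.
Qed.

(** Since no [x] in [S] is a cut-vertex, the other edges of [S] lie either all
    below [x] or all not below [x]. If no edge of [S] is above another one, then
    all have the same upper end. Otherwise some [x] is above all others; none of
    these is above another one, so they have the same upper end, which is the
    lower end of [x] because [x] is adjacent to one of them. *)
Lemma nonseparable_clique S : nonseparable S -> is_clique S.
Proof.
case/and3P=> _ connS /forallP nocut.
have connD x : x \in S -> connected_in (S :\ x).
  by move=> xS; have := nocut x; rewrite /is_cut_vertex xS negbK.
have dich x y z : x \in S -> y \in S :\ x -> z \in S :\ x ->
    above (low x) (low y) -> above (low x) (low z).
  move=> xS yS zS; have /forall_inP/(_ y yS)/forall_inP/(_ z zS) con := connD x xS.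
  by apply: (connect_in_inv (P := fun w => above (low x) (low w)) con) => u v; apply: above_step.
have same_adj y z : y != z -> par (low y) = par (low z) -> sedge y z.
  by move=> neq E; rewrite sedgeE (inj_eq low_inj) neq E eqxx !orbT.
have above_asym y z : above (low y) (low z) -> above (low z) (low y) -> y = z.
  case/andP=> le1 /eqP E1 /andP[le2 _]; apply: low_inj.
  have E : lev (low y) = lev (low z) by apply/eqP; rewrite eqn_leq le1.
  by rewrite -E1 E anc_self.
have [/existsP[x /existsP[y0 /and4P[xS y0S neq0 ab0]]]|none] := boolP [exists x, exists y,
    [&& x \in S, y \in S, y != x & above (low x) (low y)]]; last first.
  have anti u v : u \in S -> v \in S -> u != v -> ~~ above (low u) (low v).
    move=> uS vS neq; apply: contra none => ab; apply/existsP; exists u.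
    by apply/existsP; exists v; rewrite uS vS eq_sym neq.
  by move=> y z yS zS neq; apply: same_adj => //; apply: antichain_same_parent anti.
have all_below y : y \in S -> y != x -> above (low x) (low y).
  by move=> yS neq; apply: (dich x y0); rewrite ?inE ?neq ?neq0.
have anti u v : u \in S :\ x -> v \in S :\ x -> u != v -> ~~ above (low u) (low v).
  rewrite !inE => /andP[nux uS] /andP[nvx vS] nuv; apply/negP=> ab.
  have : above (low u) (low x) by apply: (dich u v); rewrite ?inE // eq_sym ?nuv ?nux.
  by move/above_asym/(_ (all_below u uS nux))/eqP; rewrite (negPf nux).
have same y z : y \in S :\ x -> z \in S :\ x -> par (low y) = par (low z).
  by move=> yS zS; apply: antichain_same_parent anti; rewrite // connD.
have [y1 y1S xy1] : exists2 y, y \in S :\ x & sedge x y.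
  have /forall_inP/(_ x xS)/forall_inP/(_ y0 y0S) /connectP[[|w p] /=] := connS.
    by move=> _ E; rewrite E eqxx in neq0.
  case/andP=> /and3P[_ wS xw] _ _; exists w => //.
  by case/andP: xw => nxw _; rewrite !inE wS andbT eq_sym.
have Px1 : par (low y1) = low x.
  have [ny1 y1S'] : y1 != x /\ y1 \in S by apply/andP; rewrite -in_setD1.
  have /andP[le1 /eqP E1] := all_below y1 y1S' ny1.
  have Ex := lev_parent tree r0R (lev_low x); have E1' := lev_parent tree r0R (lev_low y1).
  move: xy1; rewrite sedgeE => /andP[neq /or3P[/eqP-> //|/eqP E|/eqP E]].
    by rewrite E in Ex; lia.
  have El : lev (low x) = lev (low y1) by rewrite -Ex -E1' E.
  by move: E1; rewrite El anc_self => E1; rewrite E1 eqxx in neq.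
have adj_x y : y \in S :\ x -> sedge x y.
  move=> yS; have := yS; rewrite !inE => /andP[ny _].
  by rewrite sedgeE (inj_eq low_inj) eq_sym ny (same y y1) // Px1 eqxx.
move=> y z yS zS neq.
have [E|ny] := eqVneq y x; first by rewrite E adj_x // !inE zS andbT -E eq_sym.
have [E|nz] := eqVneq z x; first by rewrite sedge_sym E adj_x // !inE yS ny.
by apply: same_adj => //; apply: same; rewrite !inE ?ny ?nz.
Qed.

Lemma line_block_graph : block_graph (line_graph T).
Proof.
split; first by apply: line_connected; apply: tree.1.
by move=> B /maxsetP[/nonseparable_clique].
Qed.

End BlockGraph.

(** * One root *)

Lemma max_lev_le (T : sgraph) (R : {set T}) (h : nat) :
  \max_(v : T) gdist_set R v = h -> forall v, gdist_set R v <= h.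
Proof. by move=> <- v; apply: (leq_bigmax (F := gdist_set R)). Qed.

Lemma prod_predn_int (m : nat -> nat) a b : (forall j, a <= j < b -> 0 < m j) ->
  ((\prod_(a <= j < b) (m j).-1)%N%:Z = \prod_(a <= j < b) ((m j)%:Z - 1))%R.
Proof.
move=> m_gt0; rewrite (big_morph Posz PoszM (erefl _)) big_nat [RHS]big_nat.
by apply: eq_bigr => j /m_gt0; lia.
Qed.

(** The central clique consists of the edges at the root. An edge with lower end
    on level [t] of the tree has level [t - 1] in the line graph, and two edges
    are in the same branch when their lower ends have the same ancestor on
    level 1. *)
Section OneRoot.
Variables (h : nat) (m : nat -> nat) (T : sgraph) (w : T).
Hypotheses (h_gt0 : 0 < h) (m_ge3 : forall i, i < h -> 3 <= m i).
Hypothesis regular : level_regular_tree [set w] h m.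

Local Notation R := [set w].
Local Notation lev := (gdist_set R).
Local Notation par := (parent R w).
Local Notation anc := (ancestor R w).
Local Notation low := (lower_end R w).
Let ch (t : nat) : nat := if t == 0 then m 0 else (m t).-1.
Local Notation N := (level_size #|R| ch).
Local Notation G := (line_graph T).
Implicit Types (e f x y : G) (u v : T).

Let tree : is_tree T. Proof. by case: regular. Qed.
Let conn : is_connected T := tree.1.
Let lev_le : forall v, lev v <= h.
Proof. by apply: max_lev_le; case: regular. Qed.
Let wR : w \in R. Proof. exact: set11. Qed.
Let R_clique : is_clique R.
Proof. by move=> x y; rewrite !inE => /eqP-> /eqP->; rewrite eqxx. Qed.
Let R_le2 : #|R| <= 2. Proof. by rewrite cards1. Qed.

Let lev_dist v : lev v = gdist v w.
Proof. by have [r] := gdist_setP v wR; rewrite inE => /eqP->. Qed.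

Let lev0 v : (lev v == 0) = (v == w).
Proof. by rewrite (lev_eq0 tree wR) inE. Qed.

Let children_card v : lev v < h -> #|children R w v| = ch (lev v).
Proof.
case: regular => _ _ deg _ lt_h; have := deg v lt_h; rewrite /ch.
have [v0|lev_v] := posnP (lev v).
  have vR : v \in R by rewrite -(lev_eq0 tree wR) v0.
  by rewrite (degree_root tree wR R_clique vR) v0 cards1 addn0.
by rewrite (degree_lev_gt0 tree wR R_clique lev_v) -(prednK lev_v) => <-.
Qed.

Let ch_ge2 j : j < h -> 2 <= ch j.
Proof. by move=> lt_h; have := m_ge3 lt_h; rewrite /ch; case: eqP => [->|_]; lia. Qed.

Let N1 : N 1 = m 0.
Proof. by rewrite level_sizeS /level_size big_geq // cards1 muln1 mul1n. Qed.

(** The estimate that makes the order work: [N c >= 3 * 2 ^ (c - 1)] for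
    [c > 0], where the 3 comes from the root and the factors 2 from the other
    levels. *)
Let N_ge c : c <= h -> 2 * c + 1 <= N c.
Proof.
case: c => [|c]; first by rewrite /level_size big_geq // cards1.
elim: c => [|c IH] le_c; first by rewrite N1 m_ge3.
rewrite level_sizeS; apply: leq_trans (leq_mul (IH (ltnW le_c)) (ch_ge2 le_c)).
by lia.
Qed.

Let lev_low e : 0 < lev (low e).
Proof.
by rewrite lt0n lev0; case: (lower_endP tree wR R_clique R_le2 e).
Qed.

Let low_mem e : low e \in val e. Proof. exact: lower_end_mem. Qed.
Let par_mem e : par (low e) \in val e. Proof. exact: parent_mem. Qed.
Let low_inj : injective low. Proof. exact: lower_end_inj. Qed.
Let low_onto v : 0 < lev v -> exists e, low e = v.
Proof. by rewrite lt0n lev0; apply: lower_end_onto. Qed.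
Let card_low (P : pred T) : #|[set e | P (low e)]| = #|[set v | (0 < lev v) && P v]|.
Proof.
by rewrite card_lower_end //; apply: eq_card => v; rewrite !inE lt0n lev0.
Qed.

Let conn_G : is_connected G. Proof. exact: line_connected. Qed.

Let C : {set G} := [set e | lev (low e) == 1].
Local Notation L := (gdist_set C).

Let card_C : #|C| = m 0.
Proof.
rewrite /C (card_low (fun v => lev v == 1)) -N1.
rewrite -(card_level tree wR children_card h_gt0).
by apply: eq_card => v; rewrite !inE; case: (lev v).
Qed.

Let not_single : (#|C| == 1) = false.
Proof. by have := m_ge3 h_gt0; rewrite card_C; case: eqP => // ->. Qed.

Let C_neq0 : C != set0.
Proof. by have := m_ge3 h_gt0; rewrite -card_C -card_gt0; lia. Qed.

Let C_clique : is_clique C.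
Proof.
move=> e f; rewrite !inE => /eqP e1 /eqP f1 neq.
have par_w x : lev (low x) = 1 -> par (low x) = w.
  by move=> x1; apply/eqP; rewrite -lev0; have := lev_parent tree wR (lev_low x); lia.
apply: (line_share_edge (x := w) neq).
  by rewrite -[X in X \in _](par_w e e1) par_mem.
by rewrite -[X in X \in _](par_w f f1) par_mem.
Qed.

Let branch_dist e c : low c = anc 1 (low e) -> gdist e c <= (lev (low e)).-1.
Proof.
move=> Ec; have [->|neq] := eqVneq e c; first by rewrite gdist_xx.
have lev_e := lev_low e; have Ep := lev_parent tree wR lev_e.
have lt1 : 1 < lev (low e).
  rewrite ltn_neqAle lev_e andbT; apply: contraNneq neq => E1.
  by apply/eqP/low_inj; rewrite Ec E1 anc_self.
apply: leq_trans (line_gdist_le conn (par_mem e) (low_mem c)) _.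
rewrite Ec -(anc_parent tree wR) //.
by have := gdist_anc tree wR 1 (par (low e)); lia.
Qed.

Let level_low e : L e = (lev (low e)).-1.
Proof.
have lev_e := lev_low e; apply/eqP; rewrite eqn_leq; apply/andP; split.
  have [|c Ec] := @low_onto (anc 1 (low e)); first by rewrite (lev_anc tree wR).
  apply: leq_trans (branch_dist Ec); apply: gdist_set_le.
  by rewrite inE Ec (lev_anc tree wR).
have [c0 c0C] := set0Pn _ C_neq0; have [c] := gdist_setP e c0C.
rewrite inE => /eqP c1 ->; have : w \in val c.
  suff <- : par (low c) = w by [].
  by apply/eqP; rewrite -lev0; have := lev_parent tree wR (lev_low c); lia.
by move/(gdist_le_line conn (low_mem e)); rewrite -lev_dist; lia.
Qed.

Let low_dist e f : gdist (low e) (low f) <= (gdist e f).+1.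
Proof. exact: gdist_le_line. Qed.

Let branch_ex a t : lev a = 1 -> 0 < t <= h -> exists2 v, lev v = t & anc 1 v = a.
Proof.
move=> a1 /andP[t0 th].
have : 0 < #|[set v | (lev v == t) && (anc (lev a) v == a)]|.
  rewrite (card_level_anc tree wR children_card); last by rewrite a1 t0.
  rewrite big_nat; elim/big_ind: _ => // [x y|j /andP[_ lt_j]].
    by rewrite muln_gt0 => -> ->.
  by have := @ch_ge2 j; lia.
by case/card_gt0P=> v; rewrite inE a1 => /andP[/eqP Ev /eqP Ea]; exists v.
Qed.

(** Attained by two edges at leaves in different branches. *)
Let diameter_G : diameter G = 2 * h - 1.
Proof.
apply/eqP; rewrite eqn_leq; apply/andP; split.
  apply: diam_leP => e f; have := gdist_through_center conn_G C_neq0 C_clique e f.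
  rewrite not_single !level_low; have := lev_le (low e); have := lev_le (low f); lia.
have [e [f [eC fC neq]]] : exists e f, [/\ e \in C, f \in C & e != f].
  have : 1 < #|C| by rewrite card_C; have := m_ge3 h_gt0; lia.
  by case/card_gt1P=> e [f [eC fC neq]]; exists e, f.
move: eC fC; rewrite !inE => /eqP e1 /eqP f1.
have [|u Eu Au] := @branch_ex (low e) h e1; first by rewrite h_gt0 leqnn.
have [|v Ev Av] := @branch_ex (low f) h f1; first by rewrite h_gt0 leqnn.
have [|e' Ee'] := @low_onto u; first by rewrite Eu.
have [|f' Ef'] := @low_onto v; first by rewrite Ev.
have := gdist_le_diam e' f'; have := low_dist e' f'; rewrite Ee' Ef'.
case: (tree_dist tree wR R_clique u v) => [[[|c] [cu cv Ec le_d]]|[_ lt_d]]; try lia.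
have : anc 1 u = anc 1 v.
  by rewrite -(@anc_anc _ _ _ tree wR 1 c.+1 u) ?Ec ?(anc_anc tree wR).
by rewrite Au Av => /low_inj Eef; rewrite Eef eqxx in neq.
Qed.

Let same : rel G := fun e x => anc 1 (low x) == anc 1 (low e).

Let B := \sum_(1 <= t < h.+1) \prod_(1 <= j < t) ch j.

Let card_same e : #|[set x | same e x]| = B.
Proof.
rewrite (card_low (fun v => anc 1 v == anc 1 (low e))).
have E1 : lev (anc 1 (low e)) = 1 by apply: (lev_anc tree wR); apply: lev_low.
by have := card_branch tree wR lev_le children_card (a := anc 1 (low e)); rewrite E1 => ->.
Qed.

Let card_G : #|G| = level_offset #|R| ch h.+1.
Proof.
rewrite -(card_nonroot tree wR lev_le children_card) -cardsT.
rewrite -[RHS](eq_card (A := [set v | (0 < lev v) && predT v])).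
  by rewrite -card_low; apply: eq_card => e; rewrite !inE.
by move=> v; rewrite !inE andbT.
Qed.

Let card_T : #|T| = #|G|.+1.
Proof.
rewrite card_G -(card_nonroot tree wR lev_le children_card) -(cardC (pred1 w)) card1 add1n.
by congr _.+1; apply: eq_card => v; rewrite !inE lt0n lev0.
Qed.

Let small_branch : 2 * B < #|G|.
Proof.
have -> : #|G| = m 0 * B.
  rewrite card_G /level_offset /B big_distrr /= big_nat [RHS]big_nat.
  by apply: eq_bigr => t /andP[t0 _]; rewrite (@level_sizeD _ _ 1 t) // N1.
have B0 : 0 < B by rewrite /B big_ltn // big_geq.
by have := m_ge3 h_gt0; nia.
Qed.

Let cross e x : ~~ same e x -> L x + L e + ~~ (#|C| == 1) <= gdist x e.
Proof.
rewrite not_single !level_low => nsame; have := low_dist x e.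
have := lev_low e; have := lev_low x.
case: (tree_dist tree wR R_clique (low x) (low e)) => [[[|c] [cu cv Ec le_d]]|[_ lt_d]]; try lia.
case/negP: nsame; rewrite /same -(@anc_anc _ _ _ tree wR 1 c.+1 (low x)) ?Ec //.
by rewrite (anc_anc tree wR).
Qed.

Let inner e x : e \in C -> same e x -> gdist x e <= L x.
Proof.
rewrite inE => /eqP e1 /eqP Ex; rewrite level_low; apply: branch_dist.
by rewrite Ex -e1 anc_self.
Qed.

(** An edge not at the root is at distance at least 2 from the central edges of
    the other branches. *)
Let C_max : ~~ (#|C| == 1) -> forall x, {in C, forall c, x != c -> sedge x c} -> x \in C.
Proof.
move=> _ x adj; apply/negPn/negP => xC.
have Lx : 0 < L x by rewrite lt0n gdist_set_eq0.
have [c cC nsame] : exists2 c, c \in C & ~~ same c x.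
  have : 1 < #|C| by rewrite card_C; have := m_ge3 h_gt0; lia.
  case/card_gt1P=> c1 [c2 [c1C c2C neq]].
  have [s1|] := boolP (same c1 x); last by exists c1.
  exists c2 => //; apply: contra neq => s2; apply/eqP/low_inj.
  have self c : c \in C -> anc 1 (low c) = low c.
    by rewrite inE => /eqP c1'; rewrite -c1' anc_self.
  by rewrite -(self c1 c1C) -(self c2 c2C) -(eqP s1) -(eqP s2).
have neq : x != c by apply: contraNneq xC => ->.
have := cross nsame; have := gdist_edge (adj c cC neq); rewrite not_single; lia.
Qed.

Let rankG e := rank R w h ch (low e).

Let sum_L : \sum_e L e + #|G| = \sum_(1 <= t < h.+1) N t * t.
Proof.
have -> : \sum_e L e = \sum_(v : T) (lev v).-1.
  rewrite (eq_bigr (fun e => (lev (low e)).-1)) => [|e _]; last exact: level_low.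
  rewrite (sum_lower_end tree wR R_clique R_le2 (fun v => (lev v).-1)) [RHS](bigD1 w) //=.
  by have /eqP -> : lev w == 0 by rewrite lev0.
rewrite (sum_lev tree wR lev_le children_card predn) big_ltn // muln0 add0n.
rewrite card_G /level_offset -big_split /= big_nat [RHS]big_nat.
by apply: eq_bigr => -[|t] // _; rewrite mulnS addnC.
Qed.

Let sum_int : ((\sum_(1 <= t < h.+1) N t * t)%N%:Z =
  \sum_(1 <= i < h.+1) (m 0%N)%:Z * i%:Z * \prod_(1 <= j < i) ((m j)%:Z - 1))%R.
Proof.
rewrite (big_morph Posz PoszD (erefl _)) big_nat [RHS]big_nat.
apply: eq_bigr => i /andP[i0 ih]; rewrite (@level_sizeD _ _ 1 i) // N1.
rewrite -(prod_predn_int (m := m)) => [|j /andP[_ ji]]; last first.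
  by have := @m_ge3 j; lia.
rewrite (eq_big_nat _ _ (F2 := fun j => (m j).-1)) => [|j /andP[j0 _]].
  by rewrite !PoszM mulrAC.
by rewrite /ch; case: j j0.
Qed.

Lemma one_root_radio_number :
  lower_bound_block_graph G /\
  ((rn G)%:Z = (2 * h%:Z + 1) * (#|T|%:Z - 1) + 1
     - 2 * (\sum_(1 <= i < h.+1)
              (m 0%N)%:Z * i%:Z * \prod_(1 <= j < i) ((m j)%:Z - 1))
     - 2 * h%:Z)%R.
Proof.
have G_gt1 : 1 < #|G|.
  have := max_card (mem C); rewrite card_C; have := m_ge3 h_gt0; lia.
have N1_gt1 : 1 < N 1 by rewrite N1; have := m_ge3 h_gt0; lia.
have rank_g := rank_range tree wR lev_le children_card h_gt0 N1_gt1.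
have [] := @lower_bound_criterion G C conn_G C_neq0 C_clique
  (line_block_graph w tree) C_max same B rankG 1 G_gt1 card_same small_branch cross inner.
- by move=> e f E; apply/low_inj/(rank_inj tree wR lev_le children_card h_gt0 N1_gt1 _ _ E).
- by move=> e; rewrite card_G add1n ltnS rank_g.
(* A common ancestor on level [c] shortens the distance by at most [2 * c],
while the ranks differ by at least [N c >= 2 * c + 1]. *)
- move=> e f lt_ef; rewrite not_single !level_low.
  have := low_dist e f; have := lev_low e; have := lev_low f.
  case: (tree_dist tree wR R_clique (low e) (low f)) => [[c [cu cv Ec le_d]]|[_ lt_d]]; last lia.
  have := rank_gap tree wR lev_le children_card h_gt0 N1_gt1 (lev_low e) (lev_low f) cu cv Ec lt_ef.
  have := @N_ge c (leq_trans cu (lev_le _)); rewrite /rankG; lia.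
- move=> e f /(rank_first tree wR lev_le children_card h_gt0 N1_gt1 (lev_low e)) e1.
  rewrite add1n card_G prednK; last by rewrite -card_G ltnW.
  move/(rank_last tree wR lev_le children_card h_gt0 N1_gt1 (lev_low f)) => f1.
  by rewrite not_single !level_low e1 f1.
- move=> e; rewrite not_single diameter_G level_low; have := lev_low e; have := lev_le (low e); lia.
move=> lb ->; split=> //; rewrite not_single diameter_G -sum_int -sum_L card_T.
have -> : Posz (#|G|.-1 * (2 * h - 1 + false)) = ((#|G|%:Z - 1) * (2 * h%:Z - 1))%R.
  by rewrite addn0 PoszM; congr (_ * _)%R; lia.
rewrite -[#|G|.+1]addn1 PoszM !PoszD /= addr0; ring.
Qed.

End OneRoot.

(** * Two roots *)

(** The edge between the roots is the only central vertex, and the two sides of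
    this edge are the branches. The level of any other edge is the level of its
    lower end. *)
Section TwoRoots.
Variables (h : nat) (m : nat -> nat) (T : sgraph) (w w' : T).
Hypotheses (h_gt0 : 0 < h) (m_ge3 : forall i, i < h -> 3 <= m i) (ww' : sedge w w').
Hypothesis regular : level_regular_tree [set w; w'] h m.

Local Notation R := [set w; w'].
Local Notation lev := (gdist_set R).
Local Notation par := (parent R w').
Local Notation anc := (ancestor R w').
Local Notation low := (lower_end R w').
Let ch (t : nat) : nat := (m t).-1.
Local Notation N := (level_size #|R| ch).
Local Notation G := (line_graph T).
Implicit Types (e f x y : G) (u v : T).

Let tree : is_tree T. Proof. by case: regular. Qed.
Let conn : is_connected T := tree.1.
Let lev_le : forall v, lev v <= h.
Proof. by apply: max_lev_le; case: regular. Qed.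
Let rR : w' \in R. Proof. exact: set22. Qed.
Let R_clique : is_clique R.
Proof.
by move=> x y; rewrite !inE => /orP[]/eqP-> /orP[]/eqP->; rewrite ?eqxx // sedge_sym.
Qed.
Let w_neq : w != w'. Proof. by apply: contraTneq ww' => ->; rewrite sedge_irrefl. Qed.
Let card_R : #|R| = 2. Proof. by rewrite cards2 w_neq. Qed.
Let R_le2 : #|R| <= 2. Proof. by rewrite card_R. Qed.

Let lev0 v : (lev v == 0) = (v \in R).
Proof. exact: lev_eq0 tree rR v. Qed.

Let children_card v : lev v < h -> #|children R w' v| = ch (lev v).
Proof.
case: regular => _ _ deg _ lt_h; have := deg v lt_h; rewrite /ch => <-.
have [v0|lev_v] := posnP (lev v).
  have vR : v \in R by rewrite -lev0 v0.
  by rewrite (degree_root tree rR R_clique vR) card_R addn1.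
by rewrite (degree_lev_gt0 tree rR R_clique lev_v).
Qed.

Let ch_ge2 j : j < h -> 2 <= ch j.
Proof. by move=> lt_h; have := m_ge3 lt_h; rewrite /ch; lia. Qed.

(** The estimate that makes the order work: [N c >= 2 * 2 ^ c]. *)
Let N_ge c : c <= h -> 2 * c + 2 <= N c.
Proof.
elim: c => [|c IH] le_c; first by rewrite /level_size big_geq // card_R.
rewrite level_sizeS; apply: leq_trans (leq_mul (IH (ltnW le_c)) (ch_ge2 le_c)).
by lia.
Qed.

Let low_mem e : low e \in val e. Proof. exact: lower_end_mem. Qed.
Let par_mem e : par (low e) \in val e. Proof. exact: parent_mem. Qed.
Let low_inj : injective low. Proof. exact: lower_end_inj. Qed.
Let low_onto v : v != w' -> exists e, low e = v. Proof. exact: lower_end_onto. Qed.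
Let low_neq e : low e != w'. Proof. by case: (lower_endP tree rR R_clique R_le2 e). Qed.
Let conn_G : is_connected G. Proof. exact: line_connected. Qed.
Let low_dist e f : gdist (low e) (low f) <= (gdist e f).+1.
Proof. exact: gdist_le_line. Qed.

Let low_onto_gt0 v : 0 < lev v -> exists e, low e = v.
Proof. by rewrite lt0n lev0 !inE negb_or => /andP[_ /low_onto]. Qed.

Section CentralEdge.
Variable e0 : G.
Hypothesis low_e0 : low e0 = w.

Let C : {set G} := [set e0].
Local Notation L := (gdist_set C).

Let single : (#|C| == 1) = true. Proof. by rewrite cards1. Qed.
Let C_neq0 : C != set0. Proof. by rewrite -card_gt0 cards1. Qed.
Let C_clique : is_clique C.
Proof. by move=> x y; rewrite !inE => /eqP-> /eqP->; rewrite eqxx. Qed.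

Let L_dist e : L e = gdist e e0.
Proof. by have [c] := gdist_setP e (set11 e0); rewrite inE => /eqP->. Qed.

Let lev_low_eq0 e : (lev (low e) == 0) = (e == e0).
Proof.
rewrite lev0 !inE (negPf (low_neq e)) orbF.
by apply/eqP/eqP=> [E|->//]; apply: low_inj; rewrite E low_e0.
Qed.

Let lev_low e : e != e0 -> 0 < lev (low e).
Proof. by rewrite lt0n lev_low_eq0. Qed.

Let root_mem v : v \in R -> v \in val e0.
Proof.
have := low_mem e0; have := par_mem e0; rewrite low_e0 (parent_root tree rR (set21 w w')).
by move=> w'e we; rewrite !inE => /orP[]/eqP->.
Qed.

Let lev_anc0 v : anc 0 v \in R.
Proof. by rewrite -lev0 (lev_anc tree rR). Qed.

(** The distance to the central edge is bounded below by the distance to the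
    root on the far side, which exceeds the level by 1. *)
Let level_low e : L e = lev (low e).
Proof.
rewrite L_dist; have [->|neq] := eqVneq e e0.
  by rewrite gdist_xx; apply/esym/eqP; rewrite lev_low_eq0.
have lev_e := lev_low neq; have Ep := lev_parent tree rR lev_e.
apply/eqP; rewrite eqn_leq; apply/andP; split.
  apply: leq_trans (line_gdist_le conn (par_mem e) (root_mem (lev_anc0 (par (low e))))) _.
  by have := gdist_anc tree rR 0 (par (low e)); lia.
have [r rootr neqr] : exists2 r, r \in R & r != anc 0 (low e).
  have [E|neqw] := eqVneq (anc 0 (low e)) w; last by exists w; rewrite ?set21 // eq_sym.
  by exists w'; rewrite ?set22 // E eq_sym.
have /eqP r0 : lev r == 0 by rewrite lev0.
have := gdist_le_line conn (low_mem e) (root_mem rootr).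
case: (tree_dist tree rR R_clique (low e) r) => [[c [_ cr Ec _]]|[_ lt_d]]; last lia.
case/eqP: neqr; have c0 : c = 0 by lia.
by rewrite -c0 Ec c0 -r0 anc_self.
Qed.

Let branch_ex a : a \in R -> exists2 v, lev v = h & anc 0 v = a.
Proof.
rewrite -lev0 => /eqP a0.
have : 0 < #|[set v | (lev v == h) && (anc (lev a) v == a)]|.
  rewrite (card_level_anc tree rR children_card); last by rewrite a0 leqnn.
  rewrite big_nat; elim/big_ind: _ => // [x y|j /andP[_ lt_j]].
    by rewrite muln_gt0 => -> ->.
  by have := @ch_ge2 j; lia.
by case/card_gt0P=> v; rewrite inE a0 => /andP[/eqP Ev /eqP Ea]; exists v.
Qed.

Let common_anc0 c u v : c <= lev u -> c <= lev v -> anc c u = anc c v -> anc 0 u = anc 0 v.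
Proof.
by move=> cu cv Ec; rewrite -(@anc_anc _ _ _ tree rR 0 c u) ?Ec ?(anc_anc tree rR).
Qed.

Let diameter_G : diameter G = 2 * h.
Proof.
apply/eqP; rewrite eqn_leq; apply/andP; split.
  apply: diam_leP => e f; have := gdist_through_center conn_G C_neq0 C_clique e f.
  rewrite single !level_low; have := lev_le (low e); have := lev_le (low f); lia.
have [u Eu Au] := branch_ex (set21 w w'); have [v Ev Av] := branch_ex rR.
have [|e Ee] := @low_onto_gt0 u; first by rewrite Eu.
have [|f Ef] := @low_onto_gt0 v; first by rewrite Ev.
have := gdist_le_diam e f; have := low_dist e f; rewrite Ee Ef.
case: (tree_dist tree rR R_clique u v) => [[c [cu cv Ec le_d]]|[_ lt_d]]; last lia.
by have /eqP := common_anc0 cu cv Ec; rewrite Au Av (negPf w_neq).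
Qed.

(** The central edge belongs to no branch, although its lower end is a root. *)
Let same : rel G := fun e x => (x != e0) && (anc 0 (low x) == anc 0 (low e)).

Let B := \sum_(1 <= t < h.+1) \prod_(0 <= j < t) ch j.

Let card_low (P : pred T) :
  #|[set e | (e != e0) && P (low e)]| = #|[set v | (0 < lev v) && P v]|.
Proof.
have -> : [set e | (e != e0) && P (low e)] = [set e | ((0 < lev (low e)) && P (low e))].
  by apply/setP=> e; rewrite !inE lt0n lev_low_eq0.
rewrite (card_lower_end tree rR R_clique R_le2 (fun v => (0 < lev v) && P v)).
apply: eq_card => v; rewrite !inE; case: eqP => //= ->.
by rewrite lt0n lev0 rR.
Qed.

Let card_same e : #|[set x | same e x]| = B.
Proof.
rewrite (card_low (fun v => anc 0 v == anc 0 (low e))).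
set a := anc 0 (low e); have aR : a \in R by apply: lev_anc0.
have /eqP a0 : lev a == 0 by rewrite lev0.
have := card_branch tree rR lev_le children_card (a := a).
rewrite a0 => /(_ (leq0n h)); rewrite big_ltn // big_geq // -/B add1n.
have aE : anc 0 a = a by rewrite -[in LHS]a0 anc_self.
rewrite (cardsD1 a) inE aE eqxx /= add1n => -[<-].
apply: eq_card => v; rewrite !inE lt0n lev0.
have [->|neq] := eqVneq v a; first by rewrite aR.
case: (anc 0 v =P a) => [Ea|]; rewrite ?andbF // andbT /=.
apply: contra neq => vR; rewrite -Ea.
by move: vR; rewrite -lev0 => /eqP v0; rewrite -v0 anc_self.
Qed.

Let card_G : #|G| = (level_offset #|R| ch h.+1).+1.
Proof.
rewrite -(card_nonroot tree rR lev_le children_card) -(cardC (pred1 e0)) card1 add1n.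
congr _.+1; transitivity #|[set e | (e != e0) && predT (low e)]|.
  by apply: eq_card => e; rewrite !inE andbT.
by rewrite card_low; apply: eq_card => v; rewrite !inE andbT.
Qed.

Let card_T : #|T| = #|G|.+1.
Proof.
rewrite card_G -(card_nonroot tree rR lev_le children_card) -(cardC (mem R)).
rewrite -[#|mem R|]/#|R| card_R; congr _.+2.
by apply: eq_card => v; rewrite !inE lt0n lev0 !inE.
Qed.

Let small_branch : 2 * B < #|G|.
Proof.
rewrite card_G ltnS /level_offset /B big_distrr /= big_nat [leqRHS]big_nat.
by apply: leq_sum => t _; rewrite /level_size card_R.
Qed.

Let cross e x : ~~ same e x -> L x + L e + ~~ (#|C| == 1) <= gdist x e.
Proof.
rewrite single addn0 /same negb_and negbK => /orP[/eqP->|neq].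
  by rewrite !L_dist gdist_xx (gdist_sym conn_G).
have [->|ne] := eqVneq e e0; first by rewrite !L_dist gdist_xx addn0.
rewrite !level_low; have := low_dist x e.
case: (tree_dist tree rR R_clique (low x) (low e)) => [[c [cu cv Ec le_d]]|[_ lt_d]]; last lia.
by rewrite (common_anc0 cu cv Ec) eqxx in neq.
Qed.

Let inner e x : e \in C -> same e x -> gdist x e <= L x.
Proof. by rewrite inE L_dist => /eqP->. Qed.

Let C_max : ~~ (#|C| == 1) -> forall x, {in C, forall c, x != c -> sedge x c} -> x \in C.
Proof. by rewrite single. Qed.

Let rankG e := rank R w' h ch (low e).

Let rank_e0 : rankG e0 = 0.
Proof. by rewrite /rankG /rank lev_low_eq0 eqxx. Qed.

Let sum_L : \sum_e L e = \sum_(1 <= t < h.+1) N t * t.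
Proof.
rewrite (eq_bigr (fun e => lev (low e))) => [|e _]; last exact: level_low.
rewrite (sum_lower_end tree rR R_clique R_le2 lev).
have := sum_lev tree rR lev_le children_card id; rewrite big_ltn // muln0 add0n => <-.
rewrite [RHS](bigD1 w') //=.
by have /eqP -> : lev w' == 0 by rewrite lev0.
Qed.

Let sum_int : ((\sum_(1 <= t < h.+1) N t * t)%N%:Z =
  2 * \sum_(1 <= i < h.+1) i%:Z * \prod_(0 <= j < i) ((m j)%:Z - 1))%R.
Proof.
rewrite (big_morph Posz PoszD (erefl _)) mulr_sumr big_nat [RHS]big_nat.
apply: eq_bigr => i /andP[_ ih]; rewrite -prod_predn_int => [|j /andP[_ ji]].
  by rewrite /level_size card_R !PoszM mulrAC -mulrA.
by have := @m_ge3 j; lia.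
Qed.

Lemma central_edge_radio_number :
  lower_bound_block_graph G /\
  ((rn G)%:Z = (2 * h%:Z + 1) * (#|T|%:Z - 1)
     - 4 * (\sum_(1 <= i < h.+1) i%:Z * \prod_(0 <= j < i) ((m j)%:Z - 1))
     - 2 * h%:Z)%R.
Proof.
have N1_gt1 : 1 < N 1 by have := N_ge h_gt0; lia.
have G_gt1 : 1 < #|G|.
  rewrite card_G ltnS; have := @level_offset_le #|R| ch 2 h.+1; rewrite level_offsetS //; lia.
have rank_g := rank_range tree rR lev_le children_card h_gt0 N1_gt1.
have rank_gt0 e : e != e0 -> 0 < rankG e by move/lev_low/rank_g => /andP[].
have [] := @lower_bound_criterion G C conn_G C_neq0 C_clique
  (line_block_graph w' tree) C_max same B rankG 0 G_gt1 card_same small_branch cross inner.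
- move=> e f; have [->|ne] := eqVneq e e0; have [->|nf] := eqVneq f e0; rewrite ?rank_e0 //.
  + by move=> E; have := rank_gt0 f nf; rewrite -E.
  + by move=> E; have := rank_gt0 e ne; rewrite E.
  move=> E; apply/low_inj/(rank_inj tree rR lev_le children_card h_gt0 N1_gt1 _ _ E).
    exact: lev_low.
  exact: lev_low.
- move=> e; rewrite card_G add0n ltnS /=; have [->|ne] := eqVneq e e0; first by rewrite rank_e0.
  by case/andP: (rank_g _ (lev_low ne)).
(* On the same side, a common ancestor on level [c] shortens the distance by at
most [2 * c + 1], while the ranks differ by at least [N c >= 2 * c + 2].
Between the sides, and from [e0], no distance is shortened. *)
- move=> e f lt_ef; have nf : f != e0 by apply: contraTneq lt_ef => ->; rewrite rank_e0.
  rewrite single; have [E|ne] := eqVneq e e0.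
    by have := rank_gt0 f nf; rewrite E rank_e0 !L_dist gdist_xx (gdist_sym conn_G e0); lia.
  rewrite !level_low; have := low_dist e f.
  case: (tree_dist tree rR R_clique (low e) (low f)) => [[c [cu cv Ec le_d]]|[_ lt_d]]; last lia.
  have := rank_gap tree rR lev_le children_card h_gt0 N1_gt1
    (lev_low ne) (lev_low nf) cu cv Ec lt_ef.
  have := @N_ge c (leq_trans cu (lev_le _)); rewrite /rankG; lia.
- move=> e f re rf; have Ee : e = e0.
    by apply/eqP; apply: contraT => /rank_gt0; rewrite re.
  have nf : f != e0.
    by apply: contraTneq G_gt1 => Ef; move: rf; rewrite Ef rank_e0; lia.
  rewrite add0n card_G /= in rf.
  have := rank_last tree rR lev_le children_card h_gt0 N1_gt1 (lev_low nf) rf.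
  by rewrite single Ee L_dist gdist_xx level_low => ->.
- move=> e; rewrite single diameter_G level_low; have := lev_le (low e); lia.
move=> lb ->; split=> //; rewrite single diameter_G card_T sum_L.
have -> : Posz (#|G|.-1 * (2 * h + true)) = ((#|G|%:Z - 1) * (2 * h%:Z + 1))%R.
  by rewrite PoszM; congr (_ * _)%R; lia.
rewrite -[#|G|.+1]addn1 PoszM PoszD sum_int /=; ring.
Qed.

End CentralEdge.

Lemma two_roots_radio_number :
  lower_bound_block_graph G /\
  ((rn G)%:Z = (2 * h%:Z + 1) * (#|T|%:Z - 1)
     - 4 * (\sum_(1 <= i < h.+1) i%:Z * \prod_(0 <= j < i) ((m j)%:Z - 1))
     - 2 * h%:Z)%R.
Proof. by have [e0] := low_onto w_neq; apply: central_edge_radio_number. Qed.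

End TwoRoots.

(** * The radio numbers *)

Local Open Scope ring_scope.

Theorem corollary5p9 (h : nat) (m : nat -> nat)
    (h_ge1 : (1 <= h)%N) (m_ge3 : forall i : nat, (i < h)%N -> (3 <= m i)%N) :
  (forall T : sgraph, is_T1 h m T ->
     let d : int := 2 * h%:Z in
     let n : int := #|T|%:Z in
     lower_bound_block_graph (line_graph T) /\
     (rn (line_graph T))%:Z =
       (d + 1) * (n - 1) + 1
       - 2 * (\sum_(1 <= i < h.+1)
                (m 0%N)%:Z * i%:Z * \prod_(1 <= j < i) ((m j)%:Z - 1))
       - 2 * h%:Z) /\
  (forall T : sgraph, is_T2 h m T ->
     let d : int := 2 * h%:Z + 1 in
     let n : int := #|T|%:Z in
     lower_bound_block_graph (line_graph T) /\
     (rn (line_graph T))%:Z =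
       d * (n - 1)
       - 4 * (\sum_(1 <= i < h.+1)
                i%:Z * \prod_(0 <= j < i) ((m j)%:Z - 1))
       - 2 * h%:Z).
Proof.
split=> T.
  by case=> w regular; apply: one_root_radio_number regular.
by case=> w [w' [ww' regular]]; apply: two_roots_radio_number regular.
Qed.
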